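(* Let $L$ be an oriented link in $\mathbb{R}^3$ that is $\mathbb{Z}_2$H-thin, i.e. there is a constant $a$ such that $\mathcal{H}^{i,j}_{\mathbb{Z}_2}(L)=0$ unless $2i-j\in\{a-1,a+1\}$. Then the integral Khovanov homology $\mathcal{H}(L)=\bigoplus_{i,j}\mathcal{H}^{i,j}_{\mathbb{Z}}(L)$ contains no torsion elements of order $2^k$ for any $k>1$.
   Context: Here $\mathbb{Z}_m=\mathbb{Z}/m\mathbb{Z}$. **Khovanov homology over a commutative unital ring $R$.** Let $A=R[X]/(X^2)$, free over $R$ on $1,X$, graded by $\deg 1=1$, $\deg X=-1$, with multiplication $m(1\otimes1)=1$, $m(1\otimes X)=m(X\otimes1)=X$, $m(X\otimes X)=0$ and comultiplication $\Delta(1)=1\otimes X+X\otimes1$, $\Delta(X)=X\otimes X$. For a graded module $M$, $M\{k\}_j=M_{j-k}$. Let $D$ be a planar diagram of $L$ and $w(D)$ its writhe (number of positive minus number of negative crossings). A (Kauffman) state $s$ is a choice of a positive or negative marker at each crossing; a positive marker means the $A$-smoothing ($0$-smoothing: it joins the two regions swept out when the overstrand is rotated counterclockwise), a negative marker means the other smoothing ($1$-smoothing). Let $\sigma(s)$ be the number of positive minus the number of negative markers, and $i(s)=\frac{w(D)-\sigma(s)}2$, $j(s)=\frac{3w(D)-\sigma(s)}2$. Smoothing $D$ according to $s$ gives a family $D_s$ of $|D_s|$ disjoint circles. Put $\mathcal{A}(s)=A^{\otimes|D_s|}\{j(s)\}$ (one tensor factor per circle) and $\mathcal{C}^i_R(D)=\bigoplus_{i(s)=i}\mathcal{A}(s)$.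 States $s_+,s_-$ are adjacent if they differ at exactly one crossing, where $s_+$ has a positive and $s_-$ a negative marker. Then $D_{s_-}$ is obtained from $D_{s_+}$ by merging two circles into one or splitting one circle into two, and $d_{s_+:s_-}:\mathcal{A}(s_+)\to\mathcal{A}(s_-)$ is $m$, respectively $\Delta$, on the factors of the circles involved and the identity on the other factors. The differential is $d^i=\sum\varepsilon(s_+,s_-)\,d_{s_+:s_-}$, summed over adjacent pairs with $i(s_+)=i$, with the usual signs $\varepsilon(s_+,s_-)=\pm1$ (for a fixed ordering of the crossings, $\varepsilon=(-1)^t$ with $t$ the number of negative markers of $s_+$ at crossings preceding the one being changed). Then $d$ preserves the internal grading $j$, $d\circ d=0$, and $\mathcal{H}_R^{i,j}(L)$ is the homology of $(\mathcal{C}_R(D),d)$ in homological degree $i$ and internal degree $j$; its isomorphism class depends only on $L$. When $R$ is omitted, $R=\mathbb{Z}$. **Thinness.** $L$ is $R$H-thin if $\mathcal{H}_R(L)$ is supported on two adjacent diagonals $2i-j=\mathrm{const}$ (adjacent means that the two constants differ by $2$). *)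

(* Defs.v *)
(* Mathematical Components, with classical logic from mathcomp.classical.boolp *)
From HB Require Import structures.
From mathcomp Require Import all_boot all_order all_algebra.
From mathcomp Require Import boolp.

Set Implicit Arguments.
Unset Strict Implicit.
Unset Printing Implicit Defensive.

Import GRing.Theory.
Local Open Scope ring_scope.

(** * Oriented planar link diagrams

    A diagram is encoded as a combinatorial map (a PD code). Each crossing [c]
    has four strand ends [(c, k)], numbered counterclockwise by [k : 'Z_4]
    starting from the incoming end of the understrand. Thus the understrand
    runs from end 0 to end 2, and the overstrand runs from 3 to 1 at a positive
    crossing and from 1 to 3 at a negative one. *)

Definition strand_end (n : nat) : finType := ('I_n * 'Z_4)%type.

Definition outgoing n (positive : 'I_n -> bool) (x : strand_end n) : bool :=
  (x.2 == 2%:R) || (x.2 == (if positive x.1 then 1 else 3%:R)).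

Definition ccw n (x : strand_end n) : strand_end n := (x.1, x.2 + 1).

(* One step along the boundary of a face: traverse an edge, then turn. *)
Definition face_step n (edge : strand_end n -> strand_end n) x := ccw (edge x).

Definition graph_adj n (edge : strand_end n -> strand_end n) :
  rel (strand_end n) := [rel x y | (y == edge x) || (y == ccw x)].

(* [edge] maps each strand end to the other end of the same edge of the
   underlying 4-valent graph. [planar] is Euler's formula V - E + F = 2K for
   this graph (V = ncross, E = 2 * ncross, K connected components), i.e. the
   combinatorial map has genus 0. [nfree] is the number of components of the
   diagram that are simple closed curves without crossings. Neither the complex
   nor the link type depends on which face contains which connected component
   of the diagram, so these positions are not recorded. *)
Record diagram := Diagram {
  ncross : nat;
  nfree : nat;
  positive : 'I_ncross -> bool;
  edge : strand_end ncross -> strand_end ncross;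
  edgeK : involutive edge;
  edge_oriented : forall x, outgoing positive (edge x) = ~~ outgoing positive x;
  planar : fcard (face_step edge) predT
           = (ncross + 2 * n_comp (graph_adj edge) predT)%N
}.

(** * Kauffman states and their circles *)

Section States.
Variable D : diagram.

Definition writhe : int := \sum_(c < ncross D) (if positive c then 1 else -1).

(* A state is given by the set of crossings that carry a negative marker. *)
Definition state : finType := {set 'I_(ncross D)}.

Implicit Types (s t : state).

Definition sigma s : int := #|~: s|%:Z - #|s|%:Z.

(* The divisions by 2 are exact: writhe, sigma s and ncross D have the same
   parity. *)
Definition i_state s : int := ((writhe - sigma s) %/ 2)%Z.
Definition j_state s : int := ((3 * writhe - sigma s) %/ 2)%Z.

(* The A-smoothing joins the regions between ends 1 and 2 and between ends 3
   and 0, hence connects 0 with 1 and 2 with 3; the other smoothing connects 0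
   with 3 and 1 with 2. *)
Definition smooth s (x : strand_end (ncross D)) : strand_end (ncross D) :=
  (x.1, if x.1 \in s then 3%:R - x.2 else 1 - x.2).

(* A circle of D_s is represented by the set of points on it, where the points
   are the strand ends and one point on each crossingless component. *)
Definition point : finType := (strand_end (ncross D) + 'I_(nfree D))%type.

Definition arc s : rel point := fun p q =>
  match p, q with
  | inl x, inl y => (y == edge x) || (y == smooth s x)
  | _, _ => false
  end.

Definition circles s : {set {set point}} :=
  equivalence_partition (connect (arc s)) [set: point].

(** * The Khovanov complex

    The module A is free on 1 and X. A basis tensor of A^{⊗|D_s|} is given by
    the set of the circles of D_s whose factor is X; a basis of the whole
    complex is given by the pairs of a state and such a set. *)

Record enhanced_state := EnhancedState {
  es_val : state * {set {set point}};
  es_valP : es_val.2 \subset circles es_val.1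
}.
HB.instance Definition _ := [isSub for es_val].
HB.instance Definition _ := [Finite of enhanced_state by <:].

Definition es_state (g : enhanced_state) : state := (es_val g).1.
Definition es_X (g : enhanced_state) : {set {set point}} := (es_val g).2.

Definition i_deg (g : enhanced_state) : int := i_state (es_state g).

(* deg 1 = 1 and deg X = -1 *)
Definition j_deg (g : enhanced_state) : int :=
  j_state (es_state g)
  + \sum_(C in circles (es_state g)) (if C \in es_X g then -1 else 1).

(* Structure constants of A in the basis (1, X), the boolean [true] standing
   for X: [mul_coef a b c] is the coefficient of c in m(a ⊗ b), and
   [comul_coef a b c] is the coefficient of b ⊗ c in Delta(a). All of them
   are 0 or 1. *)
Definition mul_coef (a b c : bool) : bool :=
  match a, b with
  | false, false => ~~ c
  | false, true | true, false => c
  | true, true => false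
  end.

Definition comul_coef (a b c : bool) : bool :=
  match a with
  | false => b (+) c
  | true => b && c
  end.

(* For adjacent states [s] (as s_+) and [t] (as s_-), the coefficient in
   d_{s:t} of the basis element [Q] in the image of the basis element [P]. As
   sets of points, the circles not involved in the merge or split are exactly
   the common elements of [circles s] and [circles t]. *)
Definition edge_coef s t (P Q : {set {set point}}) : bool :=
  let old := circles s :\: circles t in
  let new := circles t :\: circles s in
  (P :\: old == Q :\: new) &&
  ([exists C1, exists C2, exists C,
      [&& C1 != C2, old == [set C1; C2], new == [set C]
        & mul_coef (C1 \in P) (C2 \in P) (C \in Q)]]
   || [exists C, exists C1, exists C2,
      [&& C1 != C2, old == [set C], new == [set C1; C2]
        & comul_coef (C \in P) (C1 \in Q) (C2 \in Q)]]).

Variable R : comNzRingType.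

(* The coefficient of [h] in d(g); at most one crossing [c] contributes. *)
Definition incidence (g h : enhanced_state) : R :=
  \sum_(c | (c \notin es_state g) && (es_state h == c |: es_state g))
     (-1) ^+ #|[set b in es_state g | (b < c)%N]|
     * (edge_coef (es_state g) (es_state h) (es_X g) (es_X h))%:R.

Definition basis (i j : int) : finType :=
  {g : enhanced_state | (i_deg g == i) && (j_deg g == j)}.

Definition chain (i j : int) : zmodType := {ffun basis i j -> R}.

(* The component of d from bidegree (i, j) to bidegree (i', j); it is used for
   i' = i + 1 only. *)
Definition diff (i i' j : int) (z : chain i j) : chain i' j :=
  [ffun h => \sum_(g : basis i j) z g * incidence (val g) (val h)].

Lemma diff_is_zmod_morphism i i' j : zmod_morphism (@diff i i' j).
Proof.
move=> z1 z2; apply/ffunP=> h; rewrite !ffunE -sumrB.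
by apply: eq_bigr => g _; rewrite !ffunE mulrBl.
Qed.

HB.instance Definition _ i i' j :=
  GRing.isZmodMorphism.Build (chain i j) (chain i' j) (@diff i i' j)
    (@diff_is_zmod_morphism i i' j).

End States.

(** * Homology of U --f--> V --g--> W at V *)

Section Homology.
Variables (U V W : zmodType) (f : {additive U -> V}) (g : {additive V -> W}).

Definition is_cycle : pred V := fun z => g z == 0.

Lemma is_cycle_zmod_closed : zmod_closed is_cycle.
Proof.
split=> [|x y]; first by rewrite /is_cycle unfold_in raddf0.
by rewrite !unfold_in raddfB => /eqP-> /eqP->; rewrite subr0.
Qed.

HB.instance Definition _ :=
  GRing.isZmodClosed.Build V is_cycle is_cycle_zmod_closed.

Record cycle_group := CycleGroup { cycle_val : V; cycle_valP : is_cycle cycle_val }.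
HB.instance Definition _ := [isSub for cycle_val].
HB.instance Definition _ := [Choice of cycle_group by <:].
HB.instance Definition _ := [SubChoice_isSubZmodule of cycle_group by <:].

Definition is_boundary : pred cycle_group :=
  fun z => `[< exists u, f u = cycle_val z >].

Lemma is_boundary_zmod_closed : zmod_closed is_boundary.
Proof.
split=> [|x y]; rewrite !unfold_in; first by apply/asboolP; exists 0; rewrite !raddf0.
move=> /asboolP[u fu] /asboolP[v fv]; apply/asboolP; exists (u - v).
by rewrite raddfB fu fv.
Qed.

HB.instance Definition _ :=
  GRing.isZmodClosed.Build cycle_group is_boundary is_boundary_zmod_closed.

Definition homology : zmodType :=
  Quotient.quot (GRing.ZmodClosed.clone cycle_group is_boundary _).

End Homology.

Definition Kh (D : diagram) (R : comNzRingType) (i j : int) : zmodType :=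
  homology (@diff D R (i - 1) i j) (@diff D R i (i + 1) j).

Definition H_thin (R : comNzRingType) (D : diagram) : Prop :=
  exists a : int, forall i j : int,
    2 * i - j <> a - 1 -> 2 * i - j <> a + 1 -> forall x : Kh D R i j, x = 0.

(** * Elements of a direct sum and their orders *)

Record direct_sum (V : int -> int -> zmodType) := DirectSum {
  component :> forall i j, V i j;
  finite_support : exists S : seq (int * int),
    forall i j, (i, j) \notin S -> component i j = 0
}.

Definition has_order (V : int -> int -> zmodType) (x : direct_sum V) (n : nat) :=
  [/\ (0 < n)%N,
      forall i j, x i j *+ n = 0
    & forall m, (0 < m < n)%N -> ~ (forall i j, x i j *+ m = 0)].

(* Main.v *)
From HB Require Import structures.
From mathcomp Require Import fingroup perm.
From mathcomp Require Import all_boot all_order all_algebra.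
From mathcomp Require Import zify ring boolp.
Require Import Defs.

(** Fix a base point on the diagram and let K be the subcomplex of the integral
    Khovanov complex spanned by the generators with X on the circle of the base
    point. Deforming X^2 = 0 to X^2 = X turns the differential d into d + T, and
    the derivation nu replacing one X by 1 satisfies d nu - nu d = 2 T over the
    integers. As the whole complex is K + nu K, it is the mapping cone of
    2 T : K -> K.

    Modulo 2 this cone splits, so thinness puts the homology of K / 2 on a single
    diagonal 2i - j = b. Hence, up to odd multiples, the homology H of K is free
    and lives on that diagonal, and (H, T) computes the homology of (K, d + T).
    In the idempotents X and 1 - X the latter complex is a sum of cubes all of
    whose edges are +1 or -1, so it has no 2-torsion. Thus T has a 2-saturated
    image on H, and the cokernel of 2 T has no element of order 4.

    That d squares to zero uses planarity: Euler's formula yields a checkerboard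
    colouring, hence an orientation of the circles that every smoothing
    respects, so that each edge of the cube is a merge or a split. *)

Set Implicit Arguments.
Unset Strict Implicit.
Unset Printing Implicit Defensive.

Import Order.TTheory GRing.Theory Num.Theory.
Local Open Scope ring_scope.

(** * Elements with an odd multiple in the image of an integral map *)

(** The argument is local at 2 but is run over the integers: odd multipliers replace the inversion
    of odd numbers, and Smith normal form replaces completeness, since an element that lies in an
    image modulo every power of 2 has an odd multiple in that image. Everything is governed by delta
    = 2i - j, which d raises by 2, T preserves and nu lowers by 2. Thus d + T is filtered by delta,
    and a class of K on the diagonal b has its copy under nu on b - 2: these are the two diagonals
    that thinness allows. The deformation X^2 = X is chosen rather than X^2 = 1 because its
    idempotents X and 1 - X form a basis over the integers; those of X^2 = 1 need the inverse of 2,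
    which would destroy the torsion under study. The idempotent basis also replaces a check of the
    Frobenius relations on pairs of surgeries: there (d + T)^2 = 0 follows from the signs of a cube,
    and its parts of delta-degree 4, 2 and 0 give d^2 = 0, dT + Td = 0 and T^2 = 0. *)

Lemma odd_multiple_int (w e : int) :
  (forall N, exists a b : int, w = a *+ 2 ^ N + b * e) ->
  exists m, exists c, odd m /\ w *+ m = c * e.
Proof.
move=> H; have [e0|e0] := eqVneq e 0.
  exists 1%N, 0; split=> //; rewrite mul0r mulr1n.
  (* The exponent [|w|] suffices: 2^|w| exceeds |w|, so a multiple of it can equal w only if w =
     0. *)
  have [a [b ]] := H `|w|%N; rewrite e0 mulr0 addr0 => wE.
  have [a0|a0] := eqVneq a 0; first by rewrite wE a0 mul0rn.
  have: (2 ^ `|w| <= `|w|)%N.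
    rewrite {2}wE -mulr_natr abszM natz absz_nat leq_pmull //.
    by rewrite absz_gt0.
  by rewrite leqNgt ltn_expl.
have e_gt0 : (0 < `|e|)%N by rewrite absz_gt0.
have [o ev oE] := pfactor_coprime (isT : prime 2) e_gt0.
(* At the 2-adic valuation of [e], multiplication by the odd part [o] of [e] turns the power of 2
   into [e] up to sign. *)
have [a [b wE]] := H (logn 2 `|e|).
exists o, (Num.sg e * a + b *+ o); split; first by rewrite -coprime2n.
have eE : Num.sg e * e = (2 ^ logn 2 `|e|)%:R * o%:R.
  by rewrite -normrEsg -natrM mulnC -oE natz abszE.
rewrite wE -(mulr_natr _ o) -(mulr_natr a) -(mulr_natr b) mulrDl mulrDl; congr (_ + _);
  last by ring.
by rewrite -mulrA -eE; ring.
Qed.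

Lemma mulmxMnl (R : pzRingType) m n p (A : 'M[R]_(m, n)) (B : 'M[R]_(n, p)) k :
  (A *+ k) *m B = (A *m B) *+ k.
Proof. exact: (raddfMn (mulmxr B)). Qed.

(** Unimodular changes of basis make the map diagonal, so the integer case applies to each
    coordinate. *)
Lemma odd_multiple_row n (M : 'M[int]_n) (z : 'rV[int]_n) :
  (forall N, exists z' u, z = z' *+ 2 ^ N + u *m M) ->
  exists m, exists u, odd m /\ z *+ m = u *m M.
Proof.
move=> H; have [L Lu [R Ru [d _ ME]]] := int_Smith_normal_form M.
set Dl := (X in L *m X *m R) in ME.
have DlE (x : 'rV[int]_n) j : (x *m Dl) 0 j = x 0 j * d`_j.
  rewrite mxE (bigD1 j) //= big1 ?addr0 => [|i ij]; first by rewrite mxE eqxx.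
  by rewrite mxE (inj_eq val_inj) (negPf ij) mulr0.
pose w := z *m invmx R.
have: forall j, exists m, exists c, odd m /\ w 0 j *+ m = c * d`_j.
  move=> j; apply: odd_multiple_int => N; have [z' [u zE]] := H N.
  exists ((z' *m invmx R) 0 j), ((u *m L) 0 j).
  rewrite -DlE /w zE mulmxDl ME !mulmxA mulmxK // mxE; congr (_ + _).
  by rewrite mulmxMnl mulmxnE.
move=> /choice[m mP].
have {}mP j : odd (m j) /\ exists c, w 0 j *+ m j = c * d`_j.
  by have [c []] := mP j; split=> //; exists c.
pose p := (\prod_j m j)%N.
have: forall j, exists c, w 0 j *+ p = c * d`_j.
  move=> j; have [_ [c wE]] := mP j.
  exists (c *+ \prod_(i | i != j) m i)%N.
  by rewrite /p (bigD1 j) //= mulrnA wE mulrnAl.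
move=> /choice[y yE].
exists p, ((\row_j y j) *m invmx L); split.
  by apply: (big_ind odd) => // [a b oa ob|i _]; [rewrite oddM oa | have [] := mP i].
rewrite ME !mulmxA mulmxKV //.
have -> : (\row_j y j) *m Dl = w *+ p.
  by apply/rowP=> j; rewrite DlE mxE -yE mulmxnE.
by rewrite mulmxMnl mulmxKV.
Qed.

Section Ffun.
Variable G : finType.
Local Notation V := {ffun G -> int}.
Implicit Types (f : {additive V -> V}) (v z : V).

Definition delta_ffun g : V := [ffun h => (g == h)%:R].

Lemma additive_ffunE f v h : f v h = \sum_g v g * f (delta_ffun g) h.
Proof.
have vE : v = \sum_g (delta_ffun g *~ v g).
  apply/ffunP=> x; rewrite sum_ffunE (bigD1 x) //= big1 => [|y yx].
    by rewrite ffunMzE ffunE eqxx addr0 intz.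
  by rewrite ffunMzE ffunE (negPf yx) mul0rz.
rewrite {1}vE raddf_sum sum_ffunE; apply: eq_bigr => g _.
by rewrite raddfMz ffunMzE -mulrzl intz.
Qed.

(** The substitute for Krull's intersection theorem at the prime 2: a descent through all powers of
    2 ends in one odd multiple. *)
Lemma odd_multiple_ffun f z :
  (forall N, exists z' u, z = z' *+ 2 ^ N + f u) ->
  exists m, exists u, odd m /\ z *+ m = f u.
Proof.
move=> H; pose r v : 'rV[int]_#|G| := \row_i v (enum_val i).
pose c (x : 'rV[int]_#|G|) : V := [ffun g => x 0 (enum_rank g)].
have rK : cancel r c by move=> v; apply/ffunP=> g; rewrite ffunE mxE enum_rankK.
have cK : cancel c r by move=> v; apply/rowP=> g; rewrite mxE ffunE enum_valK.
pose M : 'M[int]_#|G| := \matrix_(i, j) f (delta_ffun (enum_val i)) (enum_val j).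
have rf v : r (f v) = r v *m M.
  apply/rowP=> j; rewrite !mxE additive_ffunE [RHS]big_mkcond.
  rewrite (reindex (@enum_val G predT)) /=; last by apply: onW_bij; apply: enum_val_bij.
  by apply: eq_bigr => i _; rewrite !mxE.
have rn v k : r (v *+ k) = r v *+ k.
  by apply/rowP=> j; rewrite mulmxnE !mxE ffunMnE.
have [N|m [u [mo uE]]] := @odd_multiple_row _ M (r z).
  have [z' [u ->]] := H N; exists (r z'), (r u); rewrite -rf -rn.
  by apply/rowP=> j; rewrite !mxE ffunE.
by exists m, (c u); split=> //; apply: (can_inj rK); rewrite rn rf cK.
Qed.

End Ffun.

(** * The mapping cone of 2T *)

Section Support.
Variable G : finType.
Local Notation V := {ffun G -> int}.
Implicit Types (S : pred G) (v : V).

Definition ffun_proj S v : V := [ffun g => if S g then v g else 0].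

Lemma ffun_proj_is_zmod_morphism S : zmod_morphism (ffun_proj S).
Proof.
by move=> v w; apply/ffunP=> g; rewrite !ffunE; case: ifP; rewrite ?subr0.
Qed.

HB.instance Definition _ S :=
  GRing.isZmodMorphism.Build V V (ffun_proj S) (ffun_proj_is_zmod_morphism S).

Definition supported S v := forall g, ~~ S g -> v g = 0.

Lemma supported_proj S v : supported S (ffun_proj S v).
Proof. by move=> g /negPf gS; rewrite ffunE gS. Qed.

Lemma ffun_proj_id S v : supported S v -> ffun_proj S v = v.
Proof.
by move=> vS; apply/ffunP=> g; rewrite ffunE; case: ifPn => // /vS ->.
Qed.

Lemma supported_projr S S' v : supported S v -> supported S (ffun_proj S' v).
Proof. by move=> vS g /vS vg; rewrite ffunE vg if_same. Qed.

Lemma supportedD S v w : supported S v -> supported S w -> supported S (v + w).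
Proof. by move=> vS wS g gS; rewrite ffunE vS ?wS. Qed.

Lemma supportedN S v : supported S v -> supported S (- v).
Proof. by move=> vS g gS; rewrite ffunE vS ?oppr0. Qed.

Lemma supportedB S v w : supported S v -> supported S w -> supported S (v - w).
Proof. by move=> vS wS; apply/supportedD/supportedN. Qed.

Lemma supportedMn S v n : supported S v -> supported S (v *+ n).
Proof. by move=> vS g gS; rewrite ffunMnE vS ?mul0rn. Qed.

Lemma supported0 S : supported S 0.
Proof. by move=> g _; rewrite ffunE. Qed.

Lemma supportedW S S' v : (forall g, S g -> S' g) -> supported S v -> supported S' v.
Proof. by move=> SS' vS g gS; apply/vS/(contra (SS' g)). Qed.

Lemma ffun_mulIn n v w : v *+ n.+1 = w *+ n.+1 -> v = w.
Proof.
move=> /ffunP E; apply/ffunP=> g; have := E g; rewrite !ffunMnE => /eqP.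
by rewrite eqrMn2r //= => /eqP.
Qed.

End Support.
Arguments supported_proj {G} S v.
Arguments supported_projr {G S} S' {v}.

Section Cone.
Variables (G : finType) (delta_deg : G -> int) (K : pred G).
Local Notation V := {ffun G -> int}.
Definition level (n : int) := fun g => delta_deg g == n.
Definition below (n : int) := fun g => delta_deg g <= n.

Variables (d T nu : {additive V -> V}) (b : int).

Hypothesis d_lev : forall n v, d (ffun_proj (level n) v) = ffun_proj (level (n + 2)) (d v).
Hypothesis T_lev : forall n v, T (ffun_proj (level n) v) = ffun_proj (level n) (T v).
Hypothesis nu_lev : forall n v, nu (ffun_proj (level n) v) = ffun_proj (level (n - 2)) (nu v).
Hypothesis d_K : forall v, supported K v -> supported K (d v).
Hypothesis T_K : forall v, supported K v -> supported K (T v).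
Hypothesis dd : forall v, d (d v) = 0.
Hypothesis dT : forall v, d (T v) = - T (d v).
Hypothesis TT : forall v, T (T v) = 0.
Hypothesis tors : forall y z, supported K y -> supported K z -> z *+ 2 = d y + T y ->
  exists2 p, supported K p & z = d p + T p.
Hypothesis dnu : forall v, d (nu v) = nu (d v) + T v *+ 2.
Hypothesis decomp : forall c, exists k q, [/\ supported K k, supported K q & c = k + nu q].
Hypothesis decomp_uniq : forall k q, supported K k -> supported K q -> k + nu q = 0 -> k =
  0 /\ q = 0.
(** Thinness over F_2 in terms of integral chains: off two diagonals a cycle modulo 2 is a boundary
    modulo 2. The diagonal b is that of K, and b - 2 that of its copy nu K. *)
Hypothesis thin : forall n c, n <> b - 2 -> n <> b -> supported (level n) c ->
  (exists w, d c = w *+ 2) -> exists u w, c = d u + w *+ 2.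

Local Notation D v := (d v + T v).

Lemma supported_d n v : supported (level n) v -> supported (level (n + 2)) (d v).
Proof. by move=> /ffun_proj_id <-; rewrite d_lev; apply: supported_proj. Qed.

Lemma supported_T n v : supported (level n) v -> supported (level n) (T v).
Proof. by move=> /ffun_proj_id <-; rewrite T_lev; apply: supported_proj. Qed.

Lemma total_diff_sqr v : D (D v) = 0.
Proof. by rewrite !raddfD dd TT dT addr0 add0r addNr. Qed.

Lemma total_diffD v w : D (v + w) = D v + D w.
Proof. by rewrite !raddfD addrACA. Qed.

Lemma total_diffN v : D (- v) = - D v.
Proof. by rewrite !raddfN -opprD. Qed.

Lemma total_diffMn v n : D (v *+ n) = D v *+ n.
Proof. by rewrite !raddfMn mulrnDl. Qed.

Lemma supported_total_diff v : supported K v -> supported K (D v).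
Proof. by move=> vK; apply: supportedD; [apply: d_K | apply: T_K]. Qed.

Lemma decomposition_inj k q k' q' : supported K k -> supported K q -> supported K k' ->
  supported K q' ->
  k + nu q = k' + nu q' -> k = k' /\ q = q'.
Proof.
move=> kK qK kK' qK' E.
have [] := @decomp_uniq (k - k') (q - q') (supportedB kK kK') (supportedB qK qK').
  by rewrite raddfB addrACA E -opprD subrr.
by move=> /eqP; rewrite subr_eq0 => /eqP -> /eqP; rewrite subr_eq0 => /eqP ->.
Qed.

Lemma cone_diff_mod2 k q k' q' : d (k + nu q) + (k' + nu q') *+ 2 =
  d k + T q *+ 2 + k' *+ 2 + nu (d q + q' *+ 2).
Proof.
rewrite (raddfD d) dnu (raddfD nu) (raddfMn nu).
by apply/ffunP=> g; rewrite !(ffunE, ffunMnE); ring.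
Qed.

(** Modulo 2 the term 2 T disappears, so K and nu K are complementary subcomplexes and each inherits
    the vanishing. *)
Lemma thin_reduced n k w : n <> b -> supported K k -> supported (level n) k -> d k = w *+ 2 ->
  exists u w', [/\ supported K u, supported K w', supported (level (n - 2)) u,
    supported (level n) w' & k = d u + w' *+ 2].
Proof.
move=> nb kK kn kw.
suff [u [w' [uK wK' kE]]] : exists u w', [/\ supported K u, supported K w' & k = d u + w' *+ 2].
  exists (ffun_proj (level (n - 2)) u), (ffun_proj (level n) w').
  split; try by [apply: supported_projr | apply: supported_proj].
  by rewrite d_lev -{1}(ffun_proj_id kn) {1}kE raddfD raddfMn subrK.
have [nb2|nb2] := eqVneq n (b - 2).
  (* On the diagonal b - 2 thinness says nothing about [k]; its copy [nu k] is a cycle modulo 2 on b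
     - 4, where thinness applies. *)
  have [||||w1 [w2]] := @thin (n - 2) (nu k); [lia|lia| | |].
  - by rewrite -(ffun_proj_id kn) nu_lev; apply: supported_proj.
  - by exists (nu w + T k); rewrite dnu kw raddfMn mulrnDl.
  have [k1 [q1 [kK1 qK1 ->]]] := decomp w1; have [k2 [q2 [kK2 qK2 ->]]] := decomp w2.
  move=> E; exists q1, q2; split=> //.
  have [|||||_ ->//] := @decomposition_inj 0 k (d k1 + T q1 *+ 2 + k2 *+ 2) (d q1 + q2 *+ 2)
    => //.
  - exact: supported0.
  - by apply/supportedD/supportedMn => //; apply/supportedD/supportedMn;
    [apply: d_K|apply: T_K].
  - by apply/supportedD/supportedMn => //; apply: d_K.
  by rewrite add0r E cone_diff_mod2.
have [|w1 [w2]] := @thin n k (elimN eqP nb2) nb kn; first by exists w.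
have [k1 [q1 [kK1 qK1 ->]]] := decomp w1; have [k2 [q2 [kK2 qK2 ->]]] := decomp w2.
(* The cross term 2 T q1 of the cone is even and is absorbed into the remainder. *)
move=> E; exists k1, (T q1 + k2); split=> //; first by apply/supportedD => //; apply: T_K.
have [|||||-> _] := @decomposition_inj k 0 (d k1 + T q1 *+ 2 + k2 *+ 2) (d q1 + q2 *+ 2) => //.
- exact: supported0.
- by apply/supportedD/supportedMn => //; apply/supportedD/supportedMn; [apply: d_K|apply: T_K].
- by apply/supportedD/supportedMn => //; apply: d_K.
- by rewrite raddf0 addr0 E cone_diff_mod2.
by apply/ffunP=> g; rewrite !(ffunE, ffunMnE); ring.
Qed.

(** A cycle of K off the diagonal b is a boundary plus 2 w, and w is again a cycle because chains
    are torsion-free; so the division by 2 can be repeated for every N. *)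
Lemma odd_boundary n z : n <> b -> supported K z -> supported (level n) z -> d z = 0 ->
  exists m u, [/\ odd m, supported K u, supported (level (n - 2)) u & z *+ m = d u].
Proof.
move=> nb zK zn dz.
pose pK := ffun_proj (predI K (level (n - 2))).
have pKE u : supported K u -> supported (level (n - 2)) u -> pK u = u.
  move=> uK un; apply: ffun_proj_id => g; rewrite /= negb_and.
  by case/orP; [apply: uK | apply: un].
(* Composing d with [pK] forces the primitive into K and onto the diagonal n - 2. *)
have [N|m [u [mo uE]]] := @odd_multiple_ffun _ (d \o pK) z.
  suff [z' [u [[zK' zn' dz' uK un] E]]] : exists z' u, [/\ supported K z',
    supported (level n) z', d z' = 0, supported K u &
      supported (level (n - 2)) u] /\ z = z' *+ 2 ^ N + d u.
    by exists z', u; rewrite -(pKE u uK un) in E.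
  elim: N => [|N [z' [u [[zK' zn' dz' uK un] E]]]].
    exists z, 0; rewrite raddf0 addr0 mulr1n; split; last by [].
    by split=> //; apply: supported0.
  have [|u1 [w [uK1 wK1 un1 wn1 E1]]] := @thin_reduced n z' 0 nb zK' zn';
    first by rewrite dz' mul0rn.
  exists w, (u1 *+ 2 ^ N + u); split; last first.
    rewrite E {1}E1 (raddfD d) (raddfMn d) expnS.
    by apply/ffunP=> g; rewrite !(ffunE, ffunMnE); ring.
  split=> //; try by apply/supportedD => //; apply: supportedMn.
  apply: (@ffun_mulIn _ 1); rewrite mul0rn -raddfMn.
  have -> : w *+ 2 = z' - d u1 by rewrite {1}E1 addrAC subrr add0r.
  by rewrite raddfB dz' dd subrr.
exists m, (pK u); split=> // g /negPf gS; rewrite ffunE /= gS //.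
by rewrite andbF.
Qed.

(** A Bockstein argument: as d u is even, the part of [u] on b - 2 is a cycle modulo 2 where K / 2
    is acyclic, and writing it as d u1 + 2 w gives z = d w. *)
Lemma boundary_half z u : supported K z -> supported (level b) z -> supported K u -> z *+ 2 =
  d u ->
  exists u', [/\ supported K u', supported (level (b - 2)) u' & z = d u'].
Proof.
move=> zK zb uK E.
have [||||u1 [w [uK1 wK1 un1 wn1 E1]]] := @thin_reduced (b - 2) (ffun_proj (level (b - 2)) u) z.
- lia.
- exact: supported_projr.
- exact: supported_proj.
- by rewrite d_lev subrK -E raddfMn /= ffun_proj_id.
exists w; split=> //; apply: (@ffun_mulIn _ 1).
by rewrite -raddfMn -[w *+ 2](addKr (d u1)) -E1 raddfD raddfN dd oppr0 add0r d_lev subrK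
  -E raddfMn /= ffun_proj_id.
Qed.

Lemma boundary_pow2 N z u : supported K z -> supported (level b) z -> supported K u ->
  z *+ 2 ^ N = d u ->
  exists u', [/\ supported K u', supported (level (b - 2)) u' & z = d u'].
Proof.
move=> zK zb; elim: N u => [|N IH] u uK E.
  (* Already for N = 0 the primitive has to be moved to the diagonal b - 2, hence the detour through
     2 z. *)
  apply: (@boundary_half z (u *+ 2)) => //; first exact: supportedMn.
  by rewrite raddfMn -E.
have [|u' [uK' un' E']] :=
  @boundary_half _ u (supportedMn (2 ^ N) zK) (supportedMn (2 ^ N) zb) uK.
  by rewrite -mulrnA -expnSr.
exact: IH E'.
Qed.

Lemma below_top n v : supported (below n) v -> ffun_proj (level (n + 2)) v = 0.
Proof.
move=> vn; apply/ffunP=> g; rewrite !ffunE; case: ifP => // /eqP gn.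
by apply: vn; rewrite /below gn; lia.
Qed.

(** The part of D w on n + 2 is d applied to the top part of [w], which is therefore a cycle of d
    alone. Off b an odd multiple of it is d r, and subtracting D r leaves only lower diagonals. *)
Lemma lower_top n w : n <> b -> supported K w -> supported (below n) w ->
  ffun_proj (level (n + 2)) (D w) = 0 ->
  exists m r, [/\ odd m, supported K r,
    supported (level (n - 2)) r & supported (below (n - 1)) (w *+ m - D r)].
Proof.
move=> nb wK wn Dw; have wtop := below_top wn.
have [|m [r [mo rK rn E]]] :=
    @odd_boundary n (ffun_proj (level n) w) nb (supported_projr _ wK) (supported_proj _ _).
  by rewrite d_lev; move: Dw; rewrite raddfD /= -T_lev wtop raddf0 addr0.
exists m, r; split=> // g; rewrite /below -ltNge => gn.
have [gE|gE] := eqVneq (delta_deg g) n.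
  have -> : (w *+ m - D r) g = (ffun_proj (level n) w *+ m - d r) g - T r g.
    by rewrite !(ffunE, ffunMnE) /level gE eqxx; ring.
  rewrite E subrr ffunE (supported_T rn) ?subrr // /level gE; lia.
have Tr : T r g = 0 by apply: (supported_T rn); rewrite /level; lia.
have dr : d r g = 0 by apply: (supported_d rn); rewrite /level; lia.
have wg : w g = 0 by apply: wn; rewrite /below; lia.
by rewrite !(ffunE, ffunMnE) wg Tr dr mul0rn subrr.
Qed.

Lemma exists_lower_bound : exists lo, forall g, lo < delta_deg g.
Proof.
exists (- (\sum_g `|delta_deg g|)%:Z - 1) => g; rewrite (bigD1 g) //=; lia.
Qed.

Lemma D_cycle_below w : supported K w -> supported (below (b - 1)) w -> D w = 0 ->
  exists m r, [/\ odd m, supported K r, supported (below (b - 1)) r & w *+ m = D r].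
Proof.
move=> wK wb Dw; have [lo loP] := exists_lower_bound.
(* Induction on the height above a strict lower bound of all diagonals: each step clears the top
   one, and at height 0 nothing is left. *)
suff H N : lo + N%:Z < b -> forall w, supported K w -> supported (below (lo + N%:Z)) w ->
  D w = 0 ->
    exists m r, [/\ odd m, supported K r, supported (below (b - 1)) r & w *+ m = D r].
  have [lob|lob] := leP b lo.
    exists 1%N, 0; split; rewrite ?raddf0 ?addr0 //; try exact: supported0.
    by apply/ffunP=> g; rewrite ffunE wb // /below; have := loP g; lia.
  refine (H `|(b - 1 - lo)%R|%N _ w wK _ Dw); first lia.
  by apply: supportedW wb => g; rewrite /below; lia.
elim: N => [|N IH] Nb {wK wb Dw}w wK wn Dw.
  exists 1%N, 0; split; rewrite ?raddf0 ?addr0 //; try exact: supported0.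
  by apply/ffunP=> g; rewrite ffunE wn // /below; have := loP g; lia.
have [||||m [r [mo rK rn wr]]] := @lower_top (lo + N.+1%:Z) w => //; first lia.
  by rewrite Dw raddf0.
have [||||m' [r' [mo' rK' rn' E]]] := IH _ (w *+ m - D r); first lia.
- by apply: supportedB; [apply: supportedMn | apply: supported_total_diff].
- by apply: supportedW wr => g; rewrite /below; lia.
- by rewrite total_diffD total_diffN total_diffMn total_diff_sqr Dw mul0rn subrr.
exists (m * m')%N, (r *+ m' + r'); split; first by rewrite oddM mo.
- by apply/supportedD => //; apply: supportedMn.
- by apply/supportedD => //; apply/supportedMn; apply: supportedW rn => g;
  rewrite /below /level; lia.
- by rewrite total_diffD total_diffMn -E mulrnBl addrC subrK mulrnA.
Qed.

(** The diagonals above b can be cleared from the top down, because none of them is b and D p has no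
    part there. *)
Lemma D_primitive_below p : supported K p -> supported (below b) (D p) ->
  exists m p', [/\ odd m, supported K p', supported (below b) p' & D p' = D p *+ m].
Proof.
move=> pK Dp.
suff H N : forall p, supported K p -> supported (below b) (D p) ->
  supported (below (b + N%:Z)) p ->
    exists m p', [/\ odd m, supported K p', supported (below b) p' & D p' = D p *+ m].
  refine (H (\sum_g `|(delta_deg g - b)%R|)%N p pK Dp _) => g; rewrite /below (bigD1 g) //=;
    lia.
elim: N => [|N IH] {pK Dp}p pK Dp pn.
  by exists 1%N, p; split=> //; rewrite addr0 in pn.
have [||||m [r [mo rK rn pr]]] := @lower_top (b + N.+1%:Z) p => //; first lia.
  by apply/ffunP=> g; rewrite ffunE [RHS]ffunE; case: ifP => // /eqP gE; apply: Dp;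
    rewrite /below gE; lia.
have E : D (p *+ m - D r) =
  D p *+ m by rewrite total_diffD total_diffN total_diffMn total_diff_sqr subr0.
have [|||m' [p' [mo' pK' pn' E']]] := IH (p *+ m - D r).
- by apply: supportedB; [apply: supportedMn | apply: supported_total_diff].
- by rewrite E; apply: supportedMn.
- by apply: supportedW pr => g; rewrite /below; lia.
exists (m * m')%N, p'; split=> //; first by rewrite oddM mo.
by rewrite E' E mulrnA.
Qed.

Lemma D_torsion_free N y z : supported K y -> supported K z -> z *+ 2 ^ N = D y ->
  exists2 p, supported K p & z = D p.
Proof.
move=> yK zK; elim: N y yK => [|N IH] y yK E; first by exists y.
have [|p pK E'] := tors yK (supportedMn (2 ^ N) zK); first by rewrite -mulrnA -expnSr.
exact: IH E'.
Qed.

(* [k] is lifted to a cycle of [d + T] by corrections on lower diagonals, where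
   odd multiples of cycles are boundaries; [d + T] having no 2-torsion, an odd
   multiple of this cycle bounds, and a primitive can be pushed below [b]. *)
Lemma T_image_saturated N k q k3 : supported K k -> supported (level b) k -> d k = 0 ->
  supported K q -> supported (level b) q -> d q = 0 -> supported K k3 ->
    supported (level (b - 2)) k3 ->
  T q + d k3 = k *+ 2 ^ N ->
  exists m q2 k4, [/\ odd m, supported K q2, supported K k4, d q2 = 0 & k *+ m = T q2 + d k4].
Proof.
move=> kK kb dk qK qb dq k3K k3b E.
(* Applying T to the hypothesis gives 2^N T k = T (d k3) = - d (T k3), so T k is 2-power torsion on
   the diagonal b and hence a boundary. *)
have [||||u [uK ub Tk]] := @boundary_pow2 N (T k) (- T k3).
- exact: T_K.
- exact: supported_T.
- exact/supportedN/T_K.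
- by rewrite -raddfMn -E raddfD TT add0r raddfN dT opprK.
have DkE : D (k - u) = - T u by rewrite total_diffD total_diffN dk Tk add0r opprD addrA subrr
  add0r.
have [|||m [r [mo rK rb rE]]] := @D_cycle_below (T u).
- exact: T_K.
- by apply: supportedW (supported_T ub) => g; rewrite /level /below; lia.
- by rewrite -[T u]opprK -DkE total_diffN total_diff_sqr oppr0.
(* The lift: [z] is a cycle of d + T whose part on the diagonal b is m k. *)
pose z := (k - u) *+ m + r.
have zK : supported K z by apply/supportedD => //; apply/supportedMn/supportedB.
have Dz : D z = 0 by rewrite total_diffD total_diffMn DkE -rE mulNrn addNr.
have zb : supported (below b) z.
  move=> g gb; have gb' : b < delta_deg g by rewrite ltNge.
  rewrite !(ffunE, ffunMnE) kb ?ub ?rb /below /level ?sub0r ?oppr0 ?mul0rn //; lia.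
have zE : ffun_proj (level b) z = k *+ m.
  apply/ffunP=> g; rewrite !(ffunE, ffunMnE) /level; case: eqP => gb; last first.
    by rewrite kb ?mul0rn // /level; apply/eqP.
  by rewrite ub ?rb /below /level ?subr0 ?addr0 // gb; lia.
(* The parts on b cancel, so [w] is a cycle of d + T below b and an odd multiple of it bounds. *)
pose w := D ((q + k3) *+ m) - z *+ 2 ^ N.
have wE : w = T k3 *+ m - (r - u *+ m) *+ 2 ^ N.
  rewrite /w total_diffMn total_diffD dq add0r addrA E /z.
  by apply/ffunP=> g; rewrite !(ffunE, ffunMnE); ring.
have [|||m' [r' [mo' rK' rb' E']]] := @D_cycle_below w.
- by apply: supportedB; [apply/supported_total_diff/supportedMn/supportedD | apply:
  supportedMn].
- rewrite wE => g gb; have gb' : b - 1 < delta_deg g by rewrite ltNge.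
  rewrite !(ffunE, ffunMnE) (supported_T k3b) ?rb ?ub /below /level ?mul0rn ?subr0 ?mul0rn
    //; lia.
- by rewrite /w total_diffD total_diff_sqr total_diffN total_diffMn Dz mul0rn oppr0 addr0.
have [|||p pK pE] := @D_torsion_free N ((q + k3) *+ m *+ m' - r') (z *+ m').
- by apply/supportedB => //; do 2 apply: supportedMn; apply: supportedD.
- exact: supportedMn.
- rewrite total_diffD total_diffN -E' [in RHS]total_diffMn /w mulrnBl opprB addrCA subrr addr0.
  by rewrite -!mulrnA mulnC.
(* Once the primitive has no part above b, the part of D p' on b + 2 says that q2 is a cycle, and
   the part on b is the desired equation. *)
have [||m2 [p' [mo2 pK' pb' pE']]] := @D_primitive_below p => //.
  by rewrite -pE; apply: supportedMn.
exists (m * m' * m2)%N, (ffun_proj (level b) p'), (ffun_proj (level (b - 2)) p').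
split; try exact: supported_projr.
- by rewrite !oddM mo mo' mo2.
- have := congr1 (ffun_proj (level (b + 2))) pE'.
  rewrite -pE (below_top (supportedMn m2 (supportedMn m' zb))) raddfD /= -T_lev (below_top
    pb') raddf0.
  by rewrite addr0 -d_lev.
have := congr1 (ffun_proj (level b)) pE'.
rewrite -pE raddfD /= -T_lev -{1}[b](subrK 2) -d_lev.
rewrite addrC => ->.
by rewrite !raddfMn /= zE -!mulrnA mulnA.
Qed.

Lemma cone_diff k q : d (k + nu q) = d k + T q *+ 2 + nu (d q).
Proof. by rewrite raddfD dnu [nu _ + _]addrC addrA. Qed.

(** The component q of the class is torsion, so an odd multiple of it is some d r, and subtracting d
    (nu r) moves the class into K. There it is torsion modulo the image of 2 T, and saturation of
    the image of T leaves a single factor 2. *)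
Lemma cone_torsion k c u n : supported (level n) c -> d c = 0 -> c *+ 2 ^ k.+1 = d u ->
  exists m u', odd m /\ c *+ (2 * m) = d u'.
Proof.
move=> cn dc E.
have [k0 [q0 [kK0 qK0 c0]]] := decomp c.
(* Since nu lowers the diagonal by 2, [q] lives on n + 2. *)
pose x := ffun_proj (level n) k0; pose q := ffun_proj (level (n + 2)) q0.
have xK : supported K x by apply: supported_projr.
have qK : supported K q by apply: supported_projr.
have xn : supported (level n) x by apply: supported_proj.
have qn : supported (level (n + 2)) q by apply: supported_proj.
have cE : c = x + nu q.
  by rewrite -(ffun_proj_id cn) c0 raddfD /= nu_lev addrK.
have [dx dq] : d x + T q *+ 2 = 0 /\ d q = 0.
  apply: decomp_uniq; [apply/supportedD/supportedMn/T_K => //; exact: d_K | exact: d_K |].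
  by rewrite -cone_diff -cE.
have [x1 [q1 [xK1 qK1 uE]]] := decomp u.
have [xE qE] : x *+ 2 ^ k.+1 = d x1 + T q1 *+ 2 /\ q *+ 2 ^ k.+1 = d q1.
  apply: decomposition_inj; try exact: supportedMn; try exact: d_K.
    by apply/supportedD/supportedMn/T_K => //; apply: d_K.
  by rewrite -cone_diff -uE -E cE mulrnDl (raddfMn nu).
have [m [r [mo rK rn qr]]] : exists m r, [/\ odd m, supported K r,
  supported (level n) r & q *+ m = d r].
  have [nb|nb] := eqVneq (n + 2) b.
    rewrite nb in qn; have [r [rK rn ->]] := boundary_pow2 qK qn qK1 qE.
    by exists 1%N, r; split; rewrite // -nb addrK in rn *.
  by have := odd_boundary (elimN eqP nb) qK qn dq; rewrite addrK.
(* [y] is [c *+ m] minus the boundary of [nu r]; the term 2 T r is the defect of nu as a chain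
   map. *)
pose y := x *+ m - T r *+ 2.
have yK : supported K y by apply/supportedB/supportedMn/T_K => //; apply: supportedMn.
have yn : supported (level n) y by apply/supportedB/supportedMn/supported_T => //;
  apply: supportedMn.
have yE : y = c *+ m - d (nu r).
  rewrite dnu -qr (raddfMn nu) cE /y.
  by apply/ffunP=> g; rewrite !(ffunE, ffunMnE); ring.
have dy : d y = 0 by rewrite yE raddfB dd raddfMn dc mul0rn subrr.
suff [m' [u' [mo' yu]]] : exists m' u', odd m' /\ y *+ (2 * m') = d u'.
  exists (m * m')%N, (u' + nu r *+ (2 * m')); split; first by rewrite oddM mo.
  rewrite (raddfD d) (raddfMn d) -yu yE.
  by apply/ffunP=> g; rewrite !(ffunE, ffunMnE); ring.
have [nb|nb] := eqVneq n b; last first.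
  have [m' [u' [mo' _ _ yu]]] := odd_boundary (elimN eqP nb) yK yn dy.
  by exists m', (u' *+ 2); rewrite raddfMn -yu mulnC mulrnA.
rewrite {}nb in yn rn.
(* Both terms have boundary 2^(k+1) m q, so their difference is a cycle. *)
pose q' := ffun_proj (level b) (q1 *+ m - r *+ 2 ^ k.+1).
have qK' : supported K q' by apply/supported_projr/supportedB; apply: supportedMn.
have dq' : d q' = 0.
  by rewrite d_lev raddfB !(raddfMn d) -qE -qr -!mulrnA mulnC subrr raddf0.
have x1E : d (x1 *+ m) = y *+ 2 ^ k.+1 - T (q1 *+ m - r *+ 2 ^ k.+1) *+ 2.
  have -> : d (x1 *+ m) = (x *+ 2 ^ k.+1 - T q1 *+ 2) *+ m.
    by rewrite xE addrK raddfMn.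
  rewrite (raddfB T) !(raddfMn T) /y.
  by apply/ffunP=> g; rewrite !(ffunE, ffunMnE); ring.
have yq : (y *+ 2 ^ k - T q') *+ 2 = d (ffun_proj (level (b - 2)) (x1 *+ m)).
  rewrite d_lev subrK x1E (raddfB (ffun_proj _)) 2!(raddfMn (ffun_proj _)) /= -T_lev
    (ffun_proj_id yn).
  by rewrite mulrnBl -mulrnA -expnSr.
(* The factor 2 of 2 T cancels because b carries no 2-torsion; what remains says that 2^k y lies in
   the image of T on homology. *)
have [|||x3 [xK3 xn3 E3]] := boundary_half _ _ _ yq.
- by apply/supportedB/T_K => //; apply: supportedMn.
- by apply/supportedB/supported_T/supported_proj/supportedMn.
- exact/supported_projr/supportedMn.
have [|m' [q2 [k4 [mo' _ _ dq2 E4]]]] :=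
  T_image_saturated yK yn dy qK' (supported_proj _ _) dq' xK3 xn3 (N := k).
  by rewrite -E3 addrC subrK.
(* As q2 is a cycle, d (nu q2) = 2 T q2; this is where the factor 2 is needed. *)
exists m', (k4 *+ 2 + nu q2); split=> //.
rewrite (raddfD d) dnu dq2 raddf0 add0r raddfMn mulnC mulrnA E4 addrC.
by rewrite mulrnDl.
Qed.

End Cone.

(** * Checkerboard colouring of a planar diagram *)

Section InvariantFunctions.
Variables (F : fieldType) (T : finType).
Local Notation N := #|T|.

Definition row_fun (phi : 'rV[F]_N) (x : T) : F := phi 0 (enum_rank x).

Lemma row_fun_inj phi psi : row_fun phi =1 row_fun psi -> phi = psi.
Proof. by move=> E; apply/rowP=> i; have := E (enum_val i); rewrite /row_fun enum_valK. Qed.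

(** The row space consists of the functions constant on components, which have the indicator
    functions of the components as a basis. *)
Lemma rank_invariant (e : rel T) m (A : 'M[F]_(m, N)) : connect_sym e ->
  (forall phi, reflect (forall x y, e x y -> row_fun phi x = row_fun phi y) (phi <= A)%MS) ->
  \rank A = n_comp e predT.
Proof.
move=> esym AP; pose k := #|roots e|.
have -> : n_comp e predT = k by apply: eq_card => x; rewrite !inE andbT.
pose J : 'M[F]_(k, N) := \matrix_(i, j) (fingraph.root e (enum_val j) == enum_val i)%:R.
have rJ : \rank J = k.
  apply/eqP; rewrite -/(row_free J); apply/row_freeP.
  exists (\matrix_(i, j) (enum_val i == enum_val j)%:R).
  apply/matrixP=> i j; rewrite !mxE (bigD1 (enum_rank (enum_val j))) //= big1 => [|l lj].
    rewrite !mxE enum_rankK eqxx mulr1 addr0 (eqP (enum_valP j)).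
    by rewrite (inj_eq enum_val_inj) eq_sym.
  rewrite !mxE [X in _ * X](_ : _ = 0) ?mulr0 //.
  by case: eqP => // E; rewrite -E enum_valK eqxx in lj.
rewrite -rJ; apply/eqmx_rank/andP; split; last first.
  apply/row_subP=> i; apply/AP => x y exy.
  by rewrite /row_fun !mxE !enum_rankK (elimT (fingraph.rootP esym) (connect1 exy)).
apply/row_subP=> i; have /AP inv := row_sub i A.
have {}inv x y : connect e x y -> row_fun (row i A) x = row_fun (row i A) y.
  case/connectP=> p; elim: p x => [|z p IH] x /= => [_ ->//|/andP[xz zp] yE].
  by rewrite (inv _ _ xz) (IH z).
apply/submxP; exists (\row_l row_fun (row i A) (enum_val l)).
apply: row_fun_inj => x; rewrite {2}/row_fun mxE.
have rx : fingraph.root e x \in roots e by apply: (roots_root esym).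
rewrite (bigD1 (enum_rank_in rx (fingraph.root e x))) //= big1 => [|l lx].
  rewrite !mxE enum_rankK enum_rankK_in // eqxx mulr1 addr0.
  exact/inv/connect_root.
rewrite !mxE enum_rankK; case: (altP eqP) => [E|_]; last by rewrite mulr0.
by case/eqP: lx; apply: enum_val_inj; rewrite enum_rankK_in.
Qed.

Definition shift_mx (h : T -> T) : 'M[F]_N :=
  \matrix_(i, j) (i == enum_rank (h (enum_val j)))%:R.

Lemma mul_shift_mx h phi x : row_fun (phi *m shift_mx h) x = row_fun phi (h x).
Proof.
rewrite /row_fun mxE (bigD1 (enum_rank (h x))) //= big1 => [|i ix].
  by rewrite mxE enum_rankK eqxx mulr1 addr0.
by rewrite mxE enum_rankK (negPf ix) mulr0.
Qed.

Lemma row_funB phi psi x : row_fun (phi - psi) x = row_fun phi x - row_fun psi x.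
Proof. by rewrite /row_fun !mxE. Qed.

Lemma kermx_shift_mxP h phi :
  reflect (forall x, row_fun phi (h x) = row_fun phi x) (phi <= kermx (shift_mx h - 1%:M))%MS.
Proof.
rewrite sub_kermx mulmxBr mulmx1 subr_eq0.
apply: (iffP eqP) => [E x|E]; first by rewrite -mul_shift_mx E.
by apply: row_fun_inj => x; rewrite mul_shift_mx.
Qed.

Lemma rank_kermx_shift_mx h : injective h ->
  \rank (kermx (shift_mx h - 1%:M)) = fcard h predT.
Proof.
move=> hinj; apply: rank_invariant; first exact: fconnect_sym.
move=> phi; apply: (iffP (kermx_shift_mxP h phi)) => [E x y /eqP <-|E x] //.
exact/esym/E/eqxx.
Qed.

Lemma tr_shift_mx h h' : cancel h h' -> cancel h' h -> (shift_mx h)^T = shift_mx h'.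
Proof.
move=> hK h'K; apply/matrixP=> i j; rewrite !mxE; congr (_%:R); congr nat_of_bool.
apply/eqP/eqP => E.
  by rewrite E enum_rankK hK enum_valK.
by rewrite E enum_rankK h'K enum_valK.
Qed.

End InvariantFunctions.

Section Bicoloring.
Variables (T : finType) (e c c' : T -> T).
Hypotheses (eK : involutive e) (cK : cancel c c') (c'K : cancel c' c).

Local Notation adj := [rel x y | (y == e x) || (y == c x)].

Lemma adj_connect_sym : connect_sym adj.
Proof.
suff H x y : connect adj x y -> connect adj y x by move=> x y; apply/idP/idP; apply: H.
case/connectP=> p; elim: p x => [x _ ->//|z p IH] x /= /andP[xz zp] yE.
apply: connect_trans (IH z zp yE) _.
case/orP: xz => /eqP->; first by apply: connect1; rewrite /= eK eqxx.
have: fconnect c (c x) x by rewrite (fconnect_sym (can_inj cK)) fconnect1.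
by apply: connect_sub => u v /eqP <-; apply: connect1; rewrite /= eqxx orbT.
Qed.

(** [h] exchanges [q] with its complement and preserves [phi], so the sum is twice a partial sum. *)
Lemma sum_swapped0 (R : nzRingType) (h : T -> T) (q : pred T) (phi : T -> R) :
  2%N \in [pchar R] -> injective h -> (forall x, q (h x) = ~~ q x) ->
  (forall x, phi (h x) = phi x) -> \sum_x phi x = 0.
Proof.
move=> ch hinj qh ph; rewrite (bigID q) /=.
rewrite (reindex_inj hinj) /= (eq_big (fun x => ~~ q x) phi) //.
by rewrite -mulr2n -mulr_natr (pcharf0 ch) mulr0.
Qed.

(* A bicoloring solves [phi *m M = 1] over F_2 for [M = row_mx (e - 1) (c - 1)].
   It exists if [kermx M^T] is orthogonal to 1. The invariants of
   [e], of [c] and of [c \o e] contribute vectors of this kernel that are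
   orthogonal to 1, and by Euler's formula they span it. *)
Lemma euler_bicoloring (qe qc : pred T) :
  (forall x, qe (e x) = ~~ qe x) -> (forall x, qc (c x) = ~~ qc x) ->
  (fcard e predT + fcard c predT + fcard (c \o e) predT = #|T| + 2 * n_comp adj predT)%N ->
  exists eps : pred T, forall x, eps (e x) = ~~ eps x /\ eps (c x) = ~~ eps x.
Proof.
move=> qeE qcE euler; set N := #|T| in euler.
have einj := inv_inj eK; have cinj := can_inj cK.
pose P := @shift_mx 'F_2 T.
pose M : 'M['F_2]_(N, N + N) := row_mx (P e - 1%:M) (P c - 1%:M).
set K := n_comp adj _ in euler.
(* The kernel consists of the functions invariant under [e] and [c], that is, constant on
   components. *)
have rM : \rank (kermx M) = K.
  apply: (rank_invariant adj_connect_sym) => phi.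
  rewrite sub_kermx mul_mx_row -[0]row_mx0.
  apply: (iffP eqP) => [/eq_row_mx[Ee Ec] x y /orP[]/eqP->|E].
  - by apply/esym; move: x; apply/kermx_shift_mxP; rewrite sub_kermx Ee.
  - by apply/esym; move: x; apply/kermx_shift_mxP; rewrite sub_kermx Ec.
  by congr row_mx; apply/eqP; rewrite -sub_kermx; apply/kermx_shift_mxP => x; apply/esym/E;
    rewrite /= eqxx ?orbT.
have trM : M^T = col_mx (P e - 1%:M) (P c' - 1%:M).
  by rewrite tr_row_mx !linearB /= !trmx1 (tr_shift_mx _ eK eK) (tr_shift_mx _ cK c'K).
have rMT : \rank (kermx M^T) = (N + K)%N.
  rewrite mxrank_ker mxrank_tr; have := mxrank_ker M; rewrite rM.
  by have := rank_leq_row M; lia.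
have kerM (v : 'rV_N) : (forall x, row_fun v (e x) = row_fun v x) ->
    (forall x, row_fun v (c x) = row_fun v x) -> (v <= kermx M)%MS.
  move=> ve vc; rewrite sub_kermx mul_mx_row.
  have /kermx_shift_mxP := ve; rewrite sub_kermx => /eqP ->.
  have /kermx_shift_mxP := vc; rewrite sub_kermx => /eqP ->.
  by rewrite row_mx0.
have mulP h (v : 'rV_N) x : row_fun (v *m P h) x = row_fun v (h x) by apply: mul_shift_mx.
have rke : \rank (kermx (P e - 1%:M)) = fcard e predT by apply: rank_kermx_shift_mx.
have keP (v : 'rV_N) : (v <= kermx (P e - 1%:M))%MS -> forall x, row_fun v (e x) = row_fun v x.
  by move=> vk; apply/kermx_shift_mxP.
have rkc : \rank (kermx (P c' - 1%:M)) = fcard c predT.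
  rewrite -(rank_kermx_shift_mx 'F_2 cinj).
  apply: eqmx_rank; apply/andP; split; apply/row_subP=> i; apply/kermx_shift_mxP=> x.
    have /kermx_shift_mxP/(_ (c x)) := row_sub i (kermx (P c' - 1%:M)).
    by rewrite cK.
  have /kermx_shift_mxP/(_ (c' x)) := row_sub i (kermx (P c - 1%:M)).
  by rewrite c'K.
have kcP (v : 'rV_N) : (v <= kermx (P c' - 1%:M))%MS -> forall x, row_fun v (c' x) =
  row_fun v x.
  by move=> vk; apply/kermx_shift_mxP.
have rkf : \rank (kermx (P (c \o e) - 1%:M)) = fcard (c \o e) predT.
  by apply: rank_kermx_shift_mx; apply: inj_comp.
have kfP (v : 'rV_N) : (v <= kermx (P (c \o e) - 1%:M))%MS ->
    forall x, row_fun v (c (e x)) = row_fun v x.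
  by move=> /(elimT (kermx_shift_mxP _ _)).
have keM : kermx (P e - 1%:M) *m (P e - 1%:M) = 0 by apply: mulmx_ker.
have kcM : kermx (P c' - 1%:M) *m (P c' - 1%:M) = 0 by apply: mulmx_ker.
set ke := kermx (P e - 1%:M) in rke keP keM.
set kc := kermx (P c' - 1%:M) in rkc kcP kcM.
set kf := kermx (P (c \o e) - 1%:M) in rkf kfP.
pose A1 : 'M['F_2]_(N, N + N) := row_mx ke 0.
pose A2 : 'M['F_2]_(N, N + N) := row_mx 0 kc.
(* [B] sends v to the pair (v, v o e), which lies in the kernel of M^T when v is invariant under c o
   e. *)
pose B : 'M['F_2]_(N, N + N) := row_mx 1%:M (P e).
clearbody ke kc kf P.
have rA12 : \rank (A1 + A2)%MS = (fcard e predT + fcard c predT)%N.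
  by rewrite -rke -rkc -rank_diag_block_mx addsmxE /block_mx.
have rA3 : \rank (kf *m B) = fcard (c \o e) predT.
  rewrite mxrankMfree //.
  by apply/row_freeP; exists (col_mx 1%:M 0); rewrite mul_row_col mulmx1 mulmx0 addr0.
(* If (v, v o e) lies in A1 + A2, then v is invariant under [e] and [c]; so the overlap has
   dimension at most K, and Euler's formula leaves N + K dimensions for the span. *)
have rcap : (\rank ((A1 + A2) :&: (kf *m B))%MS <= K)%N.
  rewrite -rM; apply: leq_trans (mxrankM_maxl (kermx M) B).
  apply/mxrankS/rV_subP=> x; rewrite sub_capmx => /andP[/sub_addsmxP[[u1 u2] /= xE]].
  case/submxP=> w; rewrite mulmxA => xw; rewrite xw; apply: submxMr.
  move: (w *m kf) xw => v xw.
  rewrite !mul_mx_row !mulmx0 add_row_mx addr0 add0r xw mul_mx_row mulmx1 in xE.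
  have [ve vc] := eq_row_mx xE.
  have he : forall x, row_fun v (e x) = row_fun v x by apply: keP; rewrite ve submxMl.
  have hc : forall x, row_fun (v *m P e) (c' x) = row_fun (v *m P e) x.
    by apply: kcP; rewrite vc submxMl.
  apply: kerM => // y.
  by have := hc (c y); rewrite !mulP cK !he.
have sub : ((A1 + A2) + (kf *m B) <= kermx M^T)%MS.
  rewrite !addsmx_sub !sub_kermx trM !mul_row_col keM kcM !mul0mx addr0 eqxx /=.
  rewrite -mulmxA mul_row_col mul1mx mulmxBr mulmx1 addrC addrA subrK.
  apply/eqP/row_matrixP=> i; rewrite row_mul row0 mulmxBr mulmx1 mulmxA.
  apply: row_fun_inj => x; rewrite row_funB !mulP.
  have := kfP _ (row_sub i kf) (e (c' x)).
  by rewrite /= eK c'K => ->; rewrite subrr /row_fun mxE.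
have rS : (N + K <= \rank ((A1 + A2) + (kf *m B))%MS)%N.
  have := mxrank_sum_cap (A1 + A2)%MS (kf *m B); rewrite rA12 rA3; lia.
have sub' : (kermx M^T <= (A1 + A2) + (kf *m B))%MS.
  by rewrite -(geq_leqif (mxrank_leqif_sup sub)) rMT.
have ch2 : 2%N \in [pchar 'F_2] by rewrite pchar_Fp.
have sum1 (phi : 'rV['F_2]_N) : phi *m (const_mx 1 : 'cV_N) = (\sum_x row_fun phi x)%:M.
  apply/rowP=> i; rewrite ord1 !mxE mulr1n (reindex (@enum_rank T)) /=; last first.
    by apply: onW_bij; apply: enum_rank_bij.
  by apply: eq_bigr => x _; rewrite mxE mulr1.
have onesK : kermx M^T *m (const_mx 1 : 'cV_(N + N)) = 0.
  apply/eqP; rewrite -sub_kermx; apply: submx_trans sub' _.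
  rewrite !addsmx_sub !sub_kermx -col_mx_const !mul_row_col !mul0mx addr0 add0r -andbA.
  apply/and3P; split; apply/eqP/row_matrixP=> i; rewrite row_mul row0.
  - rewrite sum1 (sum_swapped0 ch2 einj qeE) ?raddf0 //.
    exact: keP (row_sub _ _).
  - rewrite sum1 (sum_swapped0 ch2 cinj qcE) ?raddf0 // => x.
    have := kcP _ (row_sub i kc) (c x).
    by rewrite cK.
  rewrite row_mul -mulmxA mul_row_col mulmxDr mul1mx mulmxA !sum1.
  rewrite [X in _ + X%:M](_ : _ = \sum_x row_fun (row i kf) x); last first.
    by rewrite [RHS](reindex_inj einj); apply: eq_bigr => x _; rewrite mulP.
  by rewrite -raddfD -mulr2n -mulr_natr (pcharf0 ch2) mulr0 raddf0.
(* Duality: a vector orthogonal to the kernel of the transpose lies in the row space. *)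
have : ((const_mx 1 : 'rV_(N + N)) <= M)%MS.
  rewrite submxE -[_ *m _]trmxK trmx_mul trmx_const.
  have /submxP[X ->] : ((cokermx M)^T <= kermx M^T)%MS.
    by rewrite sub_kermx -trmx_mul mulmx_coker trmx0.
  by rewrite -mulmxA onesK mulmx0 trmx0.
case/submxP=> phi; rewrite mul_mx_row -row_mx_const !mulmxBr !mulmx1 => /eq_row_mx[Ee Ec].
have F2 (a b : 'F_2) : 1 = a - b -> (a == 1) = (b != 1).
  by case: a b => [[|[|//]] ?] [[|[|//]] ?].
exists (fun x => row_fun phi x == 1) => x; rewrite -(mulP e) -(mulP c).
by split; apply: F2; rewrite -row_funB -?Ee -?Ec /row_fun mxE.
Qed.

End Bicoloring.

Lemma Z4_ind (P : 'Z_4 -> Prop) : P 0 -> P 1 -> P 2%:R -> P 3%:R -> forall k, P k.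
Proof.
move=> P0 P1 P2 P3 [[|[|[|[|//]]]] lt4].
- by rewrite (_ : Ordinal lt4 = 0) //; apply: val_inj.
- by rewrite (_ : Ordinal lt4 = 1) //; apply: val_inj.
- by rewrite (_ : Ordinal lt4 = 2%:R) //; apply: val_inj.
- by rewrite (_ : Ordinal lt4 = 3%:R) //; apply: val_inj.
Qed.

Section Coloring.
Variable D : diagram.

Lemma edge_neq (x : strand_end (ncross D)) : edge x != x.
Proof.
apply/eqP=> E; have := edge_oriented (d := D) x.
by rewrite E; case: outgoing.
Qed.

Definition cw n (x : strand_end n) : strand_end n := (x.1, x.2 - 1).

Lemma ccwK n : cancel (@ccw n) (@cw n).
Proof. by move=> [a j]; rewrite /ccw /cw /= addrK. Qed.

Lemma cwK n : cancel (@cw n) (@ccw n).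
Proof. by move=> [a j]; rewrite /ccw /cw /= subrK. Qed.

Lemma fcard_edge : (fcard (@edge D) predT * 2 = ncross D * 4)%N.
Proof.
rewrite (fcard_order_set (inv_inj (@edgeK D))) //.
- by rewrite card_prod !card_ord.
- apply/subsetP=> x _; rewrite inE.
  rewrite (@order_cycle _ _ [:: x; edge x]) ?inE ?eqxx //=.
    by rewrite (edgeK (d := D)) !eqxx.
  by rewrite inE eq_sym edge_neq.
Qed.

Lemma fcard_ccw n : (fcard (@ccw n) predT * 4 = n * 4)%N.
Proof.
rewrite (fcard_order_set (can_inj (@ccwK n))) //.
- by rewrite card_prod !card_ord.
- apply/subsetP=> x _; rewrite inE.
  rewrite (@order_cycle _ _ [:: x; ccw x; ccw (ccw x); ccw (ccw (ccw x))]) ?inE ?eqxx //=.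
    rewrite !eqxx /= andbT; apply/eqP; case: x => a k; congr pair.
    by elim/Z4_ind: k; apply: val_inj.
  by rewrite !inE /=; case: x => a k; rewrite /ccw !xpair_eqE !eqxx; elim/Z4_ind: k.
Qed.

(** [eps x] is the colour of the region just counterclockwise of [x]. It alternates around a
    crossing, and also along an edge, because that region lies clockwise of the other end of the
    edge. *)
Lemma diagram_coloring : exists eps : pred (strand_end (ncross D)),
  forall x, eps (edge x) = ~~ eps x /\ eps (ccw x) = ~~ eps x.
Proof.
apply: (@euler_bicoloring _ _ _ _ (@edgeK D) (@ccwK _) (@cwK _)
          (outgoing (@positive D)) (fun x => odd (val x.2))).
- exact: edge_oriented.
- by move=> [a]; elim/Z4_ind.
have := fcard_edge; have := fcard_ccw (ncross D); have := planar D.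
rewrite card_prod !card_ord /graph_adj.
have -> : fcard (face_step (@edge D)) predT = fcard (@ccw _ \o @edge D) predT by [].
set f := fcard _ predT; set g := fcard (@ccw _) predT; set h := fcard _ predT.
set m := n_comp _ _; have -> : (Zp_trunc 4).+2 = 4 by [].
clearbody f g h m; lia.
Qed.

End Coloring.

(** * Change of one marker: merge or split *)

(** A transposition changes the number of orbits by one, up or down according to whether x and y
    share an orbit. Applying it twice restores [s], so the two directions are opposite. *)
Lemma porbit_mul_tperm (T : finType) (s : {perm T}) (x y : T) : x != y ->
  (y \in porbit (tperm x y * s)%g x) = (y \notin porbit s x).
Proof.
move=> xy; have := porbits_mul_tperm s x y; have := porbits_mul_tperm (tperm x y * s)%g x y.
rewrite /= mulgA tperm2 mul1g xy (porbit_sym s) (porbit_sym (_ * s)%g).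
by case: (y \in _); case: (y \in _) => //=; lia.
Qed.

Section Join.
Variables (P : finType) (r1 r2 : rel P) (x y : P).
Hypotheses (e1 : equivalence_rel r1) (e2 : equivalence_rel r2).
Let cls (r : rel P) p := [set q | r p q].

Lemma mem_equivalence_partition (r : rel P) C :
  (C \in equivalence_partition r [set: P]) = [exists p, C == cls r p].
Proof.
apply/imsetP/existsP => [[p _ ->]|[p /eqP->]]; exists p => //.
  by apply/eqP/setP=> q; rewrite !inE.
by apply/setP=> q; rewrite !inE.
Qed.

Hypothesis nxy : ~~ r1 x y.
Hypothesis r2E : forall p q, r2 p q = r1 p q || (r1 x p || r1 y p) && (r1 x q || r1 y q).

Lemma join_partition :
  [/\ cls r1 x != cls r1 y,
      equivalence_partition r1 setT :\: equivalence_partition r2 setT = [set cls r1 x; cls r1 y]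
    & equivalence_partition r2 setT :\: equivalence_partition r1 setT =
      [set cls r1 x :|: cls r1 y]].
Proof.
have rr p : r1 p p := (e1 p p p).1.
have rt p q u : r1 p q -> r1 p u = r1 q u := (e1 p q u).2.
have rs p q : r1 p q = r1 q p.
  by apply/idP/idP => /rt E; [rewrite -E | rewrite -E].
have cE p q : (cls r1 p == cls r1 q) = r1 p q.
  apply/eqP/idP => [/setP/(_ q)|pq]; first by rewrite !inE rr.
  by apply/setP=> u; rewrite !inE; apply: rt.
have c2x : cls r2 x = cls r1 x :|: cls r1 y.
  by apply/setP=> u; rewrite !inE r2E rr /=; case: (r1 x u).
have c2y : cls r2 y = cls r1 x :|: cls r1 y.
  by apply/setP=> u; rewrite !inE r2E rr orbT /=; case: (r1 x u); case: (r1 y u).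
have c2A p : r1 x p || r1 y p -> cls r2 p = cls r1 x :|: cls r1 y.
  move=> A; apply/setP=> u; rewrite !inE r2E A /=.
  by case/orP: A => A; rewrite -(rt _ _ _ A); case: (r1 x u); case: (r1 y u).
have c2N p : ~~ (r1 x p || r1 y p) -> cls r2 p = cls r1 p.
  by move=> A; apply/setP=> u; rewrite !inE r2E (negPf A) orbF.
split; first by rewrite cE.
  apply/setP=> C; rewrite !inE !mem_equivalence_partition.
  apply/andP/orP => [[Cn /existsP[p /eqP CE]]|].
    have [/orP A|A] := boolP (r1 x p || r1 y p).
      by case: A => A; [left|right]; rewrite CE eq_sym cE.
    by case/existsP: Cn; exists p; rewrite c2N // CE.
  case=> /eqP->; split; try by apply/existsP; eexists; apply: eqxx.
    apply/existsP=> -[p /eqP/setP E]; have := E x; have := E y; rewrite !inE rr (negPf nxy).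
    move=> /esym/negbT py /esym px; have A : r1 x p || r1 y p.
      by rewrite -[_ || _]orFb; move: px; rewrite r2E => /orP[|/andP[]//]; rewrite rs => ->.
    by move: py; rewrite r2E A rr orbT /= orbT.
  apply/existsP=> -[p /eqP/setP E]; have := E y; have := E x; rewrite !inE rr rs (negPf nxy).
  move=> /esym/negbT px /esym py; have A : r1 x p || r1 y p.
    by move: py; rewrite r2E => /orP[|/andP[]//]; rewrite rs => ->; rewrite orbT.
  by move: px; rewrite r2E A rr /= orbT.
apply/setP=> C; rewrite !inE !mem_equivalence_partition.
apply/andP/eqP => [[Cn /existsP[p /eqP CE]]|->].
  have [/c2A A|A] := boolP (r1 x p || r1 y p); first by rewrite CE.
  by case/existsP: Cn; exists p; rewrite CE c2N.
split; last by apply/existsP; exists x; rewrite c2x.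
apply/existsP=> -[p /eqP/setP E]; have := E x; have := E y; rewrite !inE !rr orbT /=.
by move=> /esym py /esym; rewrite rs => px; case/negP: nxy; rewrite (rt _ _ _ px).
Qed.
End Join.

Section Surgery.
Variable D : diagram.
Local Notation strand := (strand_end (ncross D)).
Implicit Types (s t : state D) (c : 'I_(ncross D)).

Definition crossing_end c (k : 'Z_4) : point D := inl (c, k).

Lemma smoothK s : involutive (@smooth D s).
Proof. by move=> [a k]; rewrite /smooth; case: (a \in s) => /=; rewrite opprB addrC subrK. Qed.

Lemma arc_sym s : symmetric (@arc D s).
Proof.
move=> [x|i] [y|j] //=; congr (_ || _); apply/eqP/eqP => ->.
- by rewrite (edgeK (d := D)).
- by rewrite (edgeK (d := D)).
- by rewrite smoothK.
- by rewrite smoothK.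
Qed.

Lemma connect_arc_sym s : connect_sym (@arc D s).
Proof. exact/sym_connect_sym/arc_sym. Qed.

Lemma connect_arc_equiv s : equivalence_rel (connect (@arc D s)).
Proof.
move=> p q u; split; first exact: connect0.
by move=> pq; apply: (same_connect (connect_arc_sym s)).
Qed.

Variable eps : pred strand.
Hypothesis eps_edge : forall x, eps (edge x) = ~~ eps x.
Hypothesis eps_ccw : forall x, eps (ccw x) = ~~ eps x.

Lemma eps_ends c k : eps (c, k + 1) = ~~ eps (c, k).
Proof. exact: (eps_ccw (c, k)). Qed.

Lemma eps_smooth s x : eps (smooth s x) = ~~ eps x.
Proof.
case: x => c k; have e1 := eps_ends c 0; have e2 := eps_ends c 1.
have e3 := eps_ends c 2%:R; rewrite /smooth /=.
have E1 : eps (c, 1) = ~~ eps (c, 0) by rewrite -e1 add0r.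
have E2 : eps (c, 2%:R) = eps (c, 0).
  by rewrite -[RHS]negbK -E1 -e2; congr (eps (_, _)); apply: val_inj.
have E3 : eps (c, 3%:R) = ~~ eps (c, 0).
  by rewrite -E2 -e3; congr (eps (_, _)); apply: val_inj.
have S (a b d : 'Z_4) : a - b = d -> eps (c, a - b) = eps (c, d) by move->.
case: ifP => _; elim/Z4_ind: k.
- by rewrite subr0 E3.
- by rewrite (S _ _ 2%:R) ?E2 ?E1 ?negbK //; apply: val_inj.
- by rewrite (S _ _ 1) ?E2 ?E1 //; apply: val_inj.
- by rewrite subrr E3 negbK.
- by rewrite subr0 E1.
- by rewrite subrr E1 negbK.
- by rewrite (S _ _ 3%:R) ?E2 ?E3 //; apply: val_inj.
- by rewrite (S _ _ 2%:R) ?E2 ?E3 ?negbK //; apply: val_inj.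
Qed.

(** Smoothing and edge both flip [eps], so the step runs along each circle in one direction through
    the ends with [eps] true. The other ends are fixed to obtain a permutation of all strand
    ends. *)
Definition strand_step s x := if eps x then edge (smooth s x) else x.

Lemma strand_step_inj s : injective (strand_step s).
Proof.
have E x : eps (strand_step s x) = eps x.
  by rewrite /strand_step; case: ifP => [e|->//]; rewrite eps_edge eps_smooth e.
move=> x y xy; have := E x; have := E y; rewrite -xy => -> exy; move: xy.
rewrite /strand_step exy; case: ifP => // _ /(inv_inj (@edgeK D)).
exact: (inv_inj (smoothK s)).
Qed.

Definition strand_perm s := perm (@strand_step_inj s).

Lemma strand_permE s x : strand_perm s x = strand_step s x.
Proof. exact: permE. Qed.

Lemma connect_porbit s x y : eps x -> eps y ->
  connect (arc s) (inl x) (inl y) = (y \in porbit (strand_perm s) x).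
Proof.
(* [r] replaces an end with [eps] false by the other end of its edge, which lies on the same
   circle. *)
move=> ex ey; pose r z := if eps z then z else edge z.
have arcr u v : arc s u v -> match u, v with
    | inl u', inl v' => r v' \in porbit (strand_perm s) (r u') | _, _ => true end.
  case: u v => [u|i] [v|j] //= /orP[]/eqP->; rewrite /r.
    rewrite eps_edge (edgeK (d := D)) if_neg.
    by case: ifP => _; apply: porbit_id.
  rewrite eps_smooth if_neg; case: ifP => eu.
    have -> : edge (smooth s u) = strand_perm s u by rewrite permE /strand_step eu.
    by have := mem_porbit (strand_perm s) 1 u; rewrite expg1.
  rewrite porbit_sym.
  have -> : edge u = strand_perm s (smooth s u).
    by rewrite permE /strand_step eps_smooth eu /= smoothK.
  by have := mem_porbit (strand_perm s) 1 (smooth s u); rewrite expg1.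
pose a : pred (point D) := fun p =>
  if p is inl u then r u \in porbit (strand_perm s) x else false.
have cla : closed (arc s) a.
  move=> u v uv; have := arcr u v uv; move: uv; rewrite !unfold_in.
  case: u v => [u|i] [v|j] //= _; rewrite -eq_porbit_mem => /eqP E.
  by rewrite porbit_sym -E porbit_sym.
have ax : inl x \in a by rewrite unfold_in /a /r ex porbit_id.
apply/idP/idP => [/(closed_connect cla)|].
  by rewrite ax unfold_in /a /r ey => /esym.
case/porbitP=> n ->; elim: n {y ey} => [|n IH]; first by rewrite expg0 perm1 connect0.
rewrite expgSr permM; apply: connect_trans IH _; set y := ((strand_perm s ^+ n)%g x).
rewrite permE /strand_step; case: ifP => // _.
have sy : connect (arc s) (inl y) (inl (smooth s y)) by apply: connect1; rewrite /= eqxx orbT.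
by apply: connect_trans sy _; apply: connect1; rewrite /= eqxx.
Qed.

Lemma ends_smooth_even s c : c \notin s ->
  connect (arc s) (crossing_end c 0) (crossing_end c 1) /\ connect (arc s) (crossing_end c
    2%:R) (crossing_end c 3%:R).
Proof.
move=> cs; split; apply: connect1; apply/orP; right; rewrite /smooth /= (negPf cs).
  by rewrite subr0.
by apply/eqP; congr (_, _); apply: val_inj.
Qed.

Lemma ends_smooth_odd s c : c \in s ->
  connect (arc s) (crossing_end c 0) (crossing_end c 3%:R) /\ connect (arc s) (crossing_end c
    2%:R) (crossing_end c 1).
Proof.
move=> cs; split; apply: connect1; apply/orP; right; rewrite /smooth /= cs.
  by rewrite subr0.
by apply/eqP; congr (_, _); apply: val_inj.
Qed.

Lemma smooth_other s c x : x.1 != c -> smooth (c |: s) x = smooth s x.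
Proof. by rewrite /smooth !inE => /negPf->. Qed.

(** Exactly two ends of [c], opposite to each other, have [eps] true. As 3 - k = 1 - (k + 2) in
    'Z_4, the other smoothing exchanges their images. *)
Lemma strand_perm_setU1 s c (k : 'Z_4) : c \notin s -> eps (c, k) ->
  strand_perm (c |: s) = (tperm (c, k) (c, (k + 2%:R)) * strand_perm s)%g.
Proof.
move=> cs ek; have ek2 : eps (c, k + 2%:R).
  by rewrite (_ : k + 2%:R = k + 1 + 1) ?eps_ends ?ek // -addrA.
have ekN l : eps (c, l) -> (l == k) || (l == k + 2%:R).
  have := eps_ends c k; have := eps_ends c (k + 2%:R); rewrite ek ek2 => e3 e1.
  have : [|| l == k, l == k + 2%:R, l == k + 1 | l == k + 2%:R + 1].
    by elim/Z4_ind: l; elim/Z4_ind: (k).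
  by case/or4P => /eqP-> //; rewrite ?eqxx ?orbT ?e1 ?e3.
apply/perm.permP=> x; rewrite permM !strand_permE /strand_step.
have [->|x1] := eqVneq x (c, k).
  rewrite tpermL ek ek2; congr edge; rewrite /smooth /= !inE eqxx (negPf cs) /=.
  by congr (_, _); elim/Z4_ind: (k); apply: val_inj.
have [->|x2] := eqVneq x (c, k + 2%:R).
  rewrite tpermR ek ek2; congr edge; rewrite /smooth /= !inE eqxx (negPf cs) /=.
  by congr (_, _); elim/Z4_ind: (k); apply: val_inj.
rewrite tpermD 1?eq_sym //; case: ifP => // ex; congr edge; apply: smooth_other.
apply/eqP=> xc; case: x xc => a l /= -> in x1 x2 ex *.
by have := ekN l ex; rewrite !xpair_eqE !eqxx /= in x1 x2; rewrite (negPf x1) (negPf x2).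
Qed.

(* On the strand ends with [eps] true, the circles are the orbits of
   [strand_perm], which changes by a transposition when a marker is changed. *)
Lemma connect_ends_xor s c : c \notin s ->
  connect (arc (c |: s)) (crossing_end c 0) (crossing_end c 2%:R) =
    ~~ connect (arc s) (crossing_end c 0) (crossing_end c 2%:R).
Proof.
move=> cs; pose k : 'Z_4 := if eps (c, 0) then 0 else 1.
have ek : eps (c, k).
  by rewrite /k; case: ifP => // /negbT; rewrite -(eps_ends c 0) add0r.
have ek2 : eps (c, k + 2%:R).
  by rewrite (_ : k + 2%:R = k + 1 + 1) ?eps_ends ?ek // -addrA.
(* Either smoothing joins the ends 0 and 2 to the ends 1 and 3 in some order, so the two pairs are
   connected or separated together. *)
have E s' : connect (arc s') (crossing_end c 0) (crossing_end c 2%:R) =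
            connect (arc s') (crossing_end c k) (crossing_end c (k + 2%:R)).
  rewrite /k; case: ifP => _; first by rewrite add0r.
  rewrite (_ : 1 + 2%:R = 3%:R); last exact: val_inj.
  have [cs'|cs'] := boolP (c \in s').
    have [c03 c21] := ends_smooth_odd cs'.
    rewrite (same_connect (connect_arc_sym s') c03) (same_connect_r (connect_arc_sym s') c21).
    exact: connect_arc_sym.
  have [c01 c23] := ends_smooth_even cs'.
  by rewrite (same_connect (connect_arc_sym s') c01) (same_connect_r (connect_arc_sym s') c23).
rewrite !E !connect_porbit // (strand_perm_setU1 cs ek) porbit_mul_tperm //.
rewrite xpair_eqE eqxx /=; by elim/Z4_ind: (k).
Qed.

Lemma sub_arc_connect s t x y : (forall p q, arc s p q ->
  connect (arc t) p q || (connect (arc t) x p || connect (arc t) y p)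
     && (connect (arc t) x q || connect (arc t) y q)) ->
  forall p q, connect (arc s) p q ->
    connect (arc t) p q || (connect (arc t) x p || connect (arc t) y p)
     && (connect (arc t) x q || connect (arc t) y q).
Proof.
move=> H p q /connectP[l]; elim: l p => [|z l IH] p /=; first by move=> _ ->; rewrite connect0.
move=> /andP[pz zl] qE; have := IH z zl qE; have := H _ _ pz.
have tc := @same_connect _ _ (connect_arc_sym t).
have tr := @same_connect_r _ _ (connect_arc_sym t).
case/orP=> [pz'|/andP[A B]].
  by rewrite (tc _ _ pz') (tr _ _ pz') (tr _ _ pz').
case/orP=> [zq|/andP[_ ->]]; last by rewrite A orbT.
by rewrite A -!(tr _ _ zq) B orbT.
Qed.
Lemma ends_covered s c k :
  connect (arc s) (crossing_end c 0) (crossing_end c k) || connect (arc s) (crossing_end c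
    2%:R) (crossing_end c k).
Proof.
have [cs|cs] := boolP (c \in s).
  have [c03 c21] := ends_smooth_odd cs.
  by elim/Z4_ind: k; rewrite ?c03 ?c21 ?connect0 ?orbT.
have [c01 c23] := ends_smooth_even cs.
by elim/Z4_ind: k; rewrite ?c01 ?c23 ?connect0 ?orbT.
Qed.

Definition same_but s t c := forall x : strand, x.1 != c -> smooth s x = smooth t x.

Lemma same_but_arc s t c p q : same_but s t c -> arc s p q ->
  connect (arc t) p q || (connect (arc t) (crossing_end c 0) p || connect (arc t)
    (crossing_end c 2%:R) p)
     && (connect (arc t) (crossing_end c 0) q || connect (arc t) (crossing_end c 2%:R) q).
Proof.
move=> st; case: p q => [x|i] [y|j] //= /orP[]/eqP->.
  by rewrite connect1 //= eqxx.
have [<-|xc] := eqVneq x.1 c; last by rewrite (st _ xc) connect1 //= eqxx orbT.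
by case: x => a k /=; rewrite !ends_covered orbT.
Qed.

Lemma join_connect s t c : same_but s t c ->
  connect (arc t) (crossing_end c 0) (crossing_end c 2%:R) ->
  forall p q, connect (arc t) p q = connect (arc s) p q ||
    (connect (arc s) (crossing_end c 0) p || connect (arc s) (crossing_end c 2%:R) p)
     && (connect (arc s) (crossing_end c 0) q || connect (arc s) (crossing_end c 2%:R) q).
Proof.
move=> st t02 p q; apply/idP/idP.
  apply: sub_arc_connect => {}p {}q; apply: same_but_arc => x xc.
  by rewrite st.
have st' u v : connect (arc s) u v -> connect (arc t) u v.
  have /sub_arc_connect H u' v' := @same_but_arc s t c u' v' st.
  move=> /H; rewrite -!(same_connect (connect_arc_sym t) t02) !orbb => /orP[//|/andP[A B]].
  by rewrite -(same_connect (connect_arc_sym t) A).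
have A u : connect (arc s) (crossing_end c 0) u || connect (arc s) (crossing_end c 2%:R) u ->
    connect (arc t) (crossing_end c 0) u.
  by case/orP => /st' //; rewrite (same_connect (connect_arc_sym t) t02).
case/orP=> [/st'//|/andP[/A A1 /A A2]].
by rewrite -(same_connect (connect_arc_sym t) A1).
Qed.

Lemma merge_circles s t c : same_but s t c ->
  ~~ connect (arc s) (crossing_end c 0) (crossing_end c 2%:R) ->
    connect (arc t) (crossing_end c 0) (crossing_end c 2%:R) ->
  exists C1 C2, [/\ C1 != C2, circles s :\: circles t = [set C1; C2],
    circles t :\: circles s = [set C1 :|: C2] & forall k, crossing_end c k \in C1 :|: C2].
Proof.
move=> st s02 t02.
have [c12 E1 E2] := join_partition (connect_arc_equiv s) s02 (join_connect st t02).
do 2 eexists; split; [exact: c12 | exact: E1 | exact: E2 | move=> k].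
by rewrite !inE ends_covered.
Qed.

End Surgery.

(** The ends 0 and 2 lie on one circle for exactly one of the two markers. This excludes a surgery
    of one circle into one circle, for which the cube has no edge map. *)
Lemma surgery_circles D (s : state D) c : c \notin s ->
  exists C1 C2, [/\ C1 != C2, forall k, crossing_end c k \in C1 :|: C2 &
    (circles s :\: circles (c |: s) = [set C1; C2] /\
     circles (c |: s) :\: circles s = [set C1 :|: C2]) \/
    (circles s :\: circles (c |: s) = [set C1 :|: C2] /\
     circles (c |: s) :\: circles s = [set C1; C2])].
Proof.
move=> cs; have [eps epsP] := diagram_coloring D.
have ee x := (epsP x).1; have ec x := (epsP x).2.
have x02 := connect_ends_xor ee ec cs.
have st : same_but (c |: s) s c by move=> x xc; apply: smooth_other.
have ts : same_but s (c |: s) c by move=> x xc; rewrite st.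
have [s02|s02] := boolP (connect (arc s) (crossing_end c 0) (crossing_end c 2%:R));
  rewrite s02 in x02.
  have [|C1 [C2 [c12 E1 E2 E3]]] := merge_circles st _ s02; first by rewrite x02.
  by exists C1, C2; split=> //; right.
have [C1 [C2 [c12 E1 E2 E3]]] := merge_circles ts s02 x02.
by exists C1, C2; split=> //; left.
Qed.

(** * Sums over subsets and Moebius inversion *)

Section SubsetSums.
Variables (T : finType) (V : zmodType).

Lemma sum_subsets_card (Z : {set T}) (phi : nat -> V) :
  \sum_(Y : {set T} | Y \subset Z) phi #|Y| = \sum_(k < #|Z|.+1) phi k *+ 'C(#|Z|, k).
Proof.
rewrite (partition_big (fun Y : {set T} => inord #|Y| : 'I_#|Z|.+1) predT) //=.
apply: eq_bigr => k _; rewrite -(cards_draws Z k) -sumr_const.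
apply: eq_big => [Y|Y /andP[YZ /eqP <-]]; last by rewrite inordK // ltnS subset_leq_card.
rewrite inE; case: (boolP (Y \subset Z)) => //= YZ.
by rewrite -(inj_eq val_inj) /= inordK // ltnS subset_leq_card.
Qed.

Lemma sum_between (A B : {set T}) (phi : {set T} -> V) : A \subset B ->
  \sum_(Y : {set T} | (A \subset Y) && (Y \subset B)) phi Y =
  \sum_(Y : {set T} | Y \subset B :\: A) phi (A :|: Y).
Proof.
move=> AB; rewrite (reindex_onto (fun Y => A :|: Y) (fun Y => Y :\: A)) /=; last first.
  move=> Y /andP[AY _]; apply/setP=> u; rewrite !inE.
  by case: (boolP (u \in A)) => // /(subsetP AY)->.
apply: eq_bigl => Y; rewrite subsetUl subUset AB /= subsetD.
rewrite setDUl setDv set0U -[RHS]andbC andbC; congr (_ && _).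
by apply/eqP/idP => [/setDidPl|/setDidPl].
Qed.

End SubsetSums.

(** With (-1)^|A| factored out, this is the binomial expansion of a power of 1 - 1 with exponent the
    number of elements of B outside A. *)
Lemma moebius_subsets (T : finType) (A B : {set T}) :
  \sum_(Y : {set T} | (A \subset Y) && (Y \subset B)) (-1) ^+ #|Y| =
  (-1) ^+ #|A| *+ (A == B) :> int.
Proof.
have [AB|AB] := boolP (A \subset B); last first.
  rewrite big_pred0 => [|Y]; last first.
    by apply/negP=> /andP[AY YB]; case/negP: AB; apply: subset_trans YB.
  by case: eqP AB => // ->; rewrite subxx.
rewrite (sum_between _ AB).
transitivity (\sum_(Y : {set T} | Y \subset B :\: A) ((-1) ^+ #|A| * (-1) ^+ #|Y| : int)).
  apply: eq_bigr => Y; rewrite subsetD => /andP[_ YA].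
  by rewrite cardsU disjoint_setI0 1?disjoint_sym // cards0 subn0 exprD.
rewrite -mulr_sumr (sum_subsets_card _ (fun k => (-1) ^+ k)) -mulr_natr; congr (_ * _).
have := exprDn (1 : int) (-1) #|B :\: A|; rewrite subrr.
have -> : (0 ^+ #|B :\: A|)%R = (A == B)%:R :> int.
  by rewrite expr0n cards_eq0 setD_eq0 eqEsubset AB.
by move=> ->; apply: eq_bigr => i _; rewrite expr1n mul1r.
Qed.

(** * Coefficients of d and T *)

(* The structure constants of A depend only on the number [o] of circles that
   disappear (2 for a merge, 1 for a split) and on the numbers [x], [y] of
   factors X on the old and on the new circles. [turner_coef] is what the
   relation X^2 = X adds to them: m(X ⊗ X) = X and Delta(1) = ... - 1 ⊗ 1. *)
Definition diff_coef (o x y : nat) : int :=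
  if o == 2 then ((x == y) && (x <= 1)%N)%:R else ((x <= 1)%N && (y == x.+1))%:R.

Definition turner_coef (o x y : nat) : int :=
  if o == 2 then ((x == 2) && (y == 1%N))%:R else - ((x == 0%N) && (y == 0%N))%:R.

Section Local.
Variables (T : finType) (S1 S2 : {set T}).
Let old := S1 :\: S2.
Let new := S2 :\: S1.
Implicit Types (P Q : {set T}) (f : nat -> nat -> nat -> int).

Definition local_coef f P Q : int :=
  if P :\: old == Q :\: new then f #|old| #|P :&: old| #|Q :&: new| else 0.

Hypothesis old_new : (#|old| = 2 /\ #|new| = 1) \/ (#|old| = 1 /\ #|new| = 2).

(** Replacing X by 1 on a circle away from the surgery commutes with the edge map, so such terms
    cancel in the derivation formula. *)
Lemma local_coef_common P Q C : P \subset S1 -> Q \subset S2 -> C \in S1 -> C \in S2 ->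
  (if C \in P then local_coef diff_coef (P :\ C) Q else 0) =
  (if C \notin Q then local_coef diff_coef P (C |: Q) else 0).
Proof.
move=> PS QS C1 C2; have Co : C \notin old by rewrite inE C2.
have Cn : C \notin new by rewrite inE C1.
have -> : (C \in P) = (C \in P :\: old) by rewrite inE Co.
have -> : (C \in Q) = (C \in Q :\: new) by rewrite inE Cn.
rewrite /local_coef.
have -> : (P :\ C) :\: old = (P :\: old) :\ C by rewrite !setDDl setUC.
have -> : (C |: Q) :\: new = C |: (Q :\: new).
  by rewrite setDUl; congr (_ :|: _); apply/setDidPl; rewrite disjoints1.
have -> : (P :\ C) :&: old = P :&: old.
  apply/setP=> u; rewrite !inE; case: eqP => // ->.
  by rewrite C2 !andbF.
have -> : (C |: Q) :&: new = Q :&: new.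
  apply/setP=> u; rewrite !inE; case: eqP => // ->.
  by rewrite C1 !andbF.
case: (boolP (C \in P :\: old)) => CP; case: (boolP (C \in Q :\: new)) => CQ //=.
- by case: eqP => // E; rewrite -E !inE eqxx in CQ.
- congr (if _ then _ else _); apply/eqP/eqP => [<-|->]; first by rewrite setD1K.
  by rewrite setU1K.
- by case: eqP => // E; rewrite E !inE eqxx in CP.
Qed.

(** Only two cases fail to commute: m (nu (X ⊗ X)) = 2 X while nu (m (X ⊗ X)) = 0, and Delta (nu 1)
    = 0 while nu (Delta 1) = 2 (1 ⊗ 1). These are twice the terms of [turner_coef]. *)
Lemma local_coef_derivation P Q : P \subset S1 -> Q \subset S2 ->
  \sum_(C in P) local_coef diff_coef (P :\ C) Q - \sum_(C in S2 :\: Q) local_coef diff_coef P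
    (C |: Q)
  = local_coef turner_coef P Q *+ 2.
Proof.
move=> PS QS; rewrite (bigID (mem S2)) /= [X in _ - X](bigID (mem S1)) /=.
have -> : \sum_(C in P | C \in S2) local_coef diff_coef (P :\ C) Q =
          \sum_(C in S2 :\: Q | C \in S1) local_coef diff_coef P (C |: Q).
  transitivity (\sum_(C in S1 :&: S2) if C \in P then local_coef diff_coef (P :\ C) Q else 0).
    rewrite big_mkcond [RHS]big_mkcond; apply: eq_bigr => C _; rewrite inE.
    by case: (boolP (C \in P)) => [/(subsetP PS)->|] //=; case: ifP.
  transitivity (\sum_(C in S1 :&: S2) if C \notin Q then local_coef diff_coef P (C |: Q) else
    0).
    by apply: eq_bigr => C; rewrite inE => /andP[]; apply: local_coef_common.
  rewrite big_mkcond [RHS]big_mkcond; apply: eq_bigr => C _; rewrite !inE.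
  by case: (C \in S1); case: (C \in S2); case: (C \in Q).
rewrite opprD addrACA subrr add0r.
set x := #|P :&: old|; set y := #|Q :&: new|.
have -> : \sum_(C in P | C \notin S2) local_coef diff_coef (P :\ C) Q =
    (if P :\: old == Q :\: new then diff_coef #|old| x.-1 y else 0) *+ x.
  rewrite -sumr_const; apply: eq_big => C.
    by rewrite !inE; case: (boolP (C \in P)) => // /(subsetP PS) ->; rewrite andbT.
  move=> /andP[CP C2]; rewrite /local_coef.
  have Co : C \in old by rewrite inE C2 (subsetP PS).
  have -> : (P :\ C) :\: old = P :\: old.
    by rewrite setDDl; congr (_ :\: _); apply/setUidPr; rewrite sub1set.
  have -> : (P :\ C) :&: old = (P :&: old) :\ C by rewrite setIDAC.
  by rewrite /x (cardsD1 C (P :&: old)) inE CP Co.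
have -> : \sum_(C in S2 :\: Q | C \notin S1) local_coef diff_coef P (C |: Q) =
    (if P :\: old == Q :\: new then diff_coef #|old| x y.+1 else 0) *+ (#|new| - y).
  have <- : #|new :\: Q| = (#|new| - y)%N by rewrite cardsD setIC.
  rewrite -sumr_const; apply: eq_big => C.
    by rewrite !inE; case: (C \in Q); case: (C \in S1); case: (C \in S2).
  rewrite !inE => /andP[/andP[CQ C2] C1]; rewrite /local_coef.
  have Cn : C \in new by rewrite inE C2 C1.
  have -> : (C |: Q) :\: new = Q :\: new.
    by rewrite setDUl (_ : [set C] :\: new = set0) ?set0U //; apply/eqP;
      rewrite setD_eq0 sub1set.
  rewrite setIUl (_ : [set C] :&: new = [set C]); last by apply/setIidPl; rewrite sub1set.
  by rewrite cardsU1 !inE (negPf CQ).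
rewrite /local_coef; case: ifP => _; last by rewrite !mul0rn subrr.
have xo : (x <= #|old|)%N by rewrite subset_leq_card ?subsetIr.
have yn : (y <= #|new|)%N by rewrite subset_leq_card ?subsetIr.
rewrite -/x -/y; case: old_new xo yn => -[-> ->].
  by case: (x) => [|[|[|//]]]; case: (y) => [|[|//]].
by case: (x) => [|[|//]]; case: (y) => [|[|[|//]]].
Qed.

(* [C1] and [C2] stand for the circles through the base point. *)
Lemma local_coef_base0 P Q C1 C2 : P \subset S1 -> Q \subset S2 -> C1 \in P -> C2 \in S2 ->
  C2 \notin Q ->
  (C1 == C2) && (C1 \in S2) || (C1 \in old) && (C2 \in new) ->
  local_coef diff_coef P Q = 0 /\ local_coef turner_coef P Q = 0.
Proof.
move=> PS QS C1P C2S C2Q H; rewrite /local_coef; case: eqP => // E.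
case/orP: H => [/andP[/eqP C12 C1S]|/andP[C1o C2n]].
  have : (C1 \in P :\: old) = (C1 \in Q :\: new) by rewrite E.
  by rewrite !inE C1P C1S /= C12 (negPf C2Q) andbF.
have x0 : (0 < #|P :&: old|)%N by apply/card_gt0P; exists C1; rewrite inE C1P.
have yn : (#|Q :&: new| < #|new|)%N.
  apply: proper_card; rewrite properE subsetIr /=.
  by apply/subsetPn; exists C2; rewrite // inE (negPf C2Q).
have xo : (#|P :&: old| <= #|old|)%N by rewrite subset_leq_card ?subsetIr.
move: x0 yn xo; case: old_new => -[-> ->].
  by case: #|P :&: old| => [|[|[|//]]] //; case: #|Q :&: new| => [|[|//]].
by case: #|P :&: old| => [|[|//]] //; case: #|Q :&: new| => [|[|[|//]]].
Qed.

Lemma local_coef_neq0 f P Q : P \subset S1 -> Q \subset S2 -> local_coef f P Q != 0 ->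
  f #|old| #|P :&: old| #|Q :&: new| != 0 /\
  (#|S2|%:Z - (2 * #|Q|)%:Z) - (#|S1|%:Z - (2 * #|P|)%:Z) =
  #|new|%:Z - #|old|%:Z + (2 * #|P :&: old|)%:Z - (2 * #|Q :&: new|)%:Z.
Proof.
move=> PS QS; rewrite /local_coef; case: ifP => [/eqP E f0|_]; last by rewrite eqxx.
split=> //; have := cardsID old P; have := cardsID new Q; rewrite E.
have := cardsID S2 S1; have := cardsID S1 S2; rewrite -/old -/new setIC.
lia.
Qed.

Lemma local_coef_diff_degree P Q : P \subset S1 -> Q \subset S2 ->
  local_coef diff_coef P Q != 0 ->
  (#|S2|%:Z - (2 * #|Q|)%:Z) = (#|S1|%:Z - (2 * #|P|)%:Z) - 1.
Proof.
move=> PS QS /(local_coef_neq0 PS QS)[f0 E]; move: f0 E.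
case: old_new => -[-> ->]; rewrite /diff_coef /=.
  by rewrite pnatr_eq0 eqb0 negbK => /andP[/eqP-> _]; lia.
by rewrite pnatr_eq0 eqb0 negbK => /andP[_ /eqP->]; lia.
Qed.

Lemma local_coef_turner_degree P Q : P \subset S1 -> Q \subset S2 ->
  local_coef turner_coef P Q != 0 ->
  (#|S2|%:Z - (2 * #|Q|)%:Z) = (#|S1|%:Z - (2 * #|P|)%:Z) + 1.
Proof.
move=> PS QS /(local_coef_neq0 PS QS)[f0 E]; move: f0 E.
case: old_new => -[-> ->]; rewrite /turner_coef /=.
  by rewrite pnatr_eq0 eqb0 negbK => /andP[/eqP-> /eqP->]; lia.
by rewrite oppr_eq0 pnatr_eq0 eqb0 negbK => /andP[/eqP-> /eqP->]; lia.
Qed.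

(** Off the new circles [Q] is forced, and on them the coefficient depends only on their number in
    [Q], whence the binomials. *)
Lemma sum_loc f P (E : {set T}) : P \subset S1 -> E \subset S2 ->
  \sum_(Q : {set T} | Q \subset E) local_coef f P Q =
  if P :\: old \subset E then
    \sum_(k < #|E :&: new|.+1) f #|old| #|P :&: old| k *+ 'C(#|E :&: new|, k) else 0.
Proof.
move=> PS ES; have Pn : [disjoint P :\: old & new].
  rewrite -setI_eq0; apply/eqP/setP=> u; rewrite !inE.
  by case: (boolP (u \in P)) => [/(subsetP PS)->|]; rewrite ?andbF.
rewrite -(sum_subsets_card _ (f #|old| #|P :&: old|)).
rewrite /local_coef -big_mkcondr /=; case: ifP => PE; last first.
  apply: big_pred0 => Q; apply/negP=> /andP[QE /eqP E1].
  by case/negP: PE; rewrite E1; apply: subset_trans QE; apply: subsetDl.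
rewrite (reindex_onto (fun Y => (P :\: old) :|: Y) (fun Q => Q :&: new)) /=; last first.
  by move=> Q /andP[_ /eqP->]; rewrite setUC setID.
apply: eq_big => [Y|Y].
  rewrite subUset PE /= subsetI setDUl setIUl (disjoint_setI0 Pn) set0U.
  rewrite (_ : (P :\: old) :\: new = P :\: old); last exact/setDidPl.
  case: (boolP (Y \subset E)) => //= YE; apply/andP/idP => [[_ /eqP/setIidPl//]|Yn].
  split; last by apply/eqP/setIidPl.
  by rewrite (_ : Y :\: new = set0) ?setU0 //; apply/eqP; rewrite setD_eq0.
case/andP=> _ /eqP YE; congr (f _ _ _); congr #|pred_of_set _|.
exact: YE.
Qed.

End Local.

(** * Operators on the complex *)

Section Kernels.
Variable G : finType.
Local Notation V := {ffun G -> int}.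

Definition kernel_op (M : G -> G -> int) (v : V) : V := [ffun h => \sum_g v g * M g h].

Lemma kernel_op_is_zmod_morphism M : zmod_morphism (kernel_op M).
Proof.
move=> v w; apply/ffunP=> h; rewrite !ffunE -sumrB.
by apply: eq_bigr => g _; rewrite !ffunE mulrBl.
Qed.

HB.instance Definition _ M :=
  GRing.isZmodMorphism.Build V V (kernel_op M) (kernel_op_is_zmod_morphism M).

Lemma kernel_op_comp M N v h : kernel_op N (kernel_op M v) h =
  \sum_g v g * \sum_k M g k * N k h.
Proof.
rewrite ffunE; under eq_bigr do rewrite ffunE mulr_suml.
rewrite exchange_big; apply: eq_bigr => g _; rewrite mulr_sumr.
by apply: eq_bigr => k _; rewrite mulrA.
Qed.

Lemma kernel_op_lev (delta_deg : G -> int) M m n v :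
  (forall g h, M g h != 0 -> delta_deg h = delta_deg g + m) ->
  kernel_op M (ffun_proj (level delta_deg n) v) =
    ffun_proj (level delta_deg (n + m)) (kernel_op M v).
Proof.
move=> Mm; apply/ffunP=> h; rewrite !ffunE /level big_mkcond /=.
transitivity (\sum_g if delta_deg h == n + m then v g * M g h else 0).
  apply: eq_bigr => g _; rewrite !ffunE /level.
  have [->|/Mm ->] := eqVneq (M g h) 0; first by rewrite !mulr0; case: ifP.
  by rewrite (inj_eq (addIr _)); case: ifP; rewrite ?mul0r.
by case: ifP => // _; rewrite big1.
Qed.

Lemma kernel_op_on (K : pred G) M v :
  (forall g h, M g h != 0 -> K g -> K h) -> supported K v -> supported K (kernel_op M v).
Proof.
move=> MK vK h hK; rewrite ffunE big1 // => g _.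
have [->|/MK gh] := eqVneq (M g h) 0; first by rewrite mulr0.
by rewrite vK ?mul0r //; apply: contra hK.
Qed.

End Kernels.

Section SetSums.
Variables (T : finType) (V : zmodType).
Implicit Types P Q S : {set T}.

Lemma sum_del1 P (phi : {set T} -> V) :
  \sum_(Q : {set T} | (Q \subset P) && (#|P :\: Q| == 1%N)) phi Q = \sum_(C in P) phi (P :\ C).
Proof.
have inj : {in P &, injective (fun C => P :\ C)}.
  move=> C C' CP C'P /setP/(_ C'); rewrite !inE C'P eqxx andbT /= => /negbT.
  by rewrite negbK => /eqP.
rewrite -(big_imset phi inj) /=; apply: eq_bigl => Q.
apply/andP/imsetP => [[QP /cards1P[C CE]]|[C CP ->]].
  exists C; first by have /setP/(_ C) := CE; rewrite !inE eqxx => /andP[].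
  by rewrite -CE setDDr setDv set0U; apply/esym/setIidPr.
rewrite subsetDl setDDr setDv set0U (_ : P :&: [set C] = [set C]) ?cards1 //.
by apply/setIidPr; rewrite sub1set.
Qed.

Lemma sum_add1 P S (phi : {set T} -> V) : P \subset S ->
  \sum_(Q : {set T} | [&& Q \subset S, P \subset Q & #|Q :\: P| == 1%N]) phi Q =
  \sum_(C in S :\: P) phi (C |: P).
Proof.
move=> PS; have inj : {in S :\: P &, injective (fun C => C |: P)}.
  move=> C C'; rewrite !inE => /andP[CP _] /andP[C'P _] /setP/(_ C).
  by rewrite !inE eqxx (negPf CP) !orbF => /esym /eqP.
rewrite -(big_imset phi inj) /=; apply: eq_bigl => Q.
apply/and3P/imsetP => [[QS PQ /cards1P[C CE]]|[C]].
  have /setP/(_ C) := CE; rewrite !inE eqxx => /andP[CP CQ].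
  exists C; first by rewrite inE CP (subsetP QS).
  by rewrite -CE; apply/setP=> u; rewrite !inE; case: (boolP (u \in P)) =>
    [/(subsetP PQ)->|_] //=; rewrite orbF.
rewrite inE => /andP[CP CS] ->; rewrite subUset sub1set CS PS subsetUr; split=> //.
rewrite setDUl setDv setU0 (_ : [set C] :\: P = [set C]) ?cards1 //.
by apply/setDidPl; rewrite disjoints1.
Qed.
End SetSums.

(** * The differential, its deformation and nu on enhanced states *)

Section Khovanov.
Variable D : diagram.
Local Notation G := (enhanced_state D).
Implicit Types (s t : state D) (g h : G).

Lemma es_XP g : es_X g \subset circles (es_state g).
Proof. exact: es_valP. Qed.

Lemma es_eq g h : es_state g = es_state h -> es_X g = es_X h -> g = h.
Proof.
by move=> Es EX; apply: val_inj; apply/eqP; rewrite -pair_eqE /pair_eq /= -/(es_state g)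
  -/(es_state h) -/(es_X g) -/(es_X h) Es EX !eqxx.
Qed.

Lemma sum_es (V : zmodType) t (phi : {set {set point D}} -> V) :
  \sum_(g : G | es_state g == t) phi (es_X g) =
  \sum_(Q : {set {set point D}} | Q \subset circles t) phi Q.
Proof.
pose g0 : G := @EnhancedState D (t, set0) (sub0set _).
rewrite (reindex_onto (@es_X D) (fun Q => insubd g0 (t, Q))) => [|Q Qt] /=; last first.
  by rewrite /es_X val_insubd /= Qt.
apply: eq_bigl => g; apply/eqP/andP => [<-|[gt /eqP <-]].
  by rewrite es_XP; split=> //; apply/eqP/val_inj;
    rewrite val_insubd /= es_XP -surjective_pairing.
by rewrite /es_state val_insubd /= gt.
Qed.

Definition cube_sign s t : int :=
  \sum_(c | (c \notin s) && (t == c |: s)) (-1) ^+ #|[set b in s | (b < c)%N]|.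

Lemma cube_signU1 s c : c \notin s -> cube_sign s (c |: s) =
  (-1) ^+ #|[set b in s | (b < c)%N]|.
Proof.
move=> cs; rewrite /cube_sign (bigD1 c) ?cs ?eqxx //= big1 ?addr0 // => b.
case/andP=> /andP[bs /eqP/setP/(_ b)]; rewrite !inE eqxx /= (negPf bs) orbF => /eqP ->.
by rewrite eqxx.
Qed.

Lemma cube_sign0 s t : cube_sign s t != 0 -> exists2 c, c \notin s & t = c |: s.
Proof.
move=> H; have [c /andP[cs /eqP tE]|none] := pickP (fun c => (c \notin s) && (t == c |: s)).
  by exists c.
by move: H; rewrite /cube_sign big_pred0 ?eqxx.
Qed.

Definition old s t := circles s :\: circles t.

Lemma surgery_cards s c : c \notin s -> let t := c |: s in
  (#|old s t| = 2 /\ #|old t s| = 1) \/ (#|old s t| = 1 /\ #|old t s| = 2).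
Proof.
move=> cs /=; have [C1 [C2 [c12 _ []]]] := surgery_circles cs; rewrite /old => -[-> ->];
  rewrite cards1 cards2 c12; [by left | by right].
Qed.

Definition cube_kernel f g h : int := cube_sign (es_state g) (es_state h) *
  local_coef (circles (es_state g)) (circles (es_state h)) f (es_X g) (es_X h).

Definition nu_kernel g h : int :=
  [&& es_state g == es_state h, es_X h \subset es_X g & #|es_X g :\: es_X h| == 1%N]%:R.

Local Notation dK := (cube_kernel diff_coef).
Local Notation TK := (cube_kernel turner_coef).

(** The sign of an edge depends only on the states, which nu fixes, so the formula reduces to a
    single surgery. *)
Lemma cube_kernel_derivation g h :
  \sum_k nu_kernel g k * dK k h - \sum_k dK g k * nu_kernel k h = TK g h *+ 2.
Proof.
set s := es_state g; set t := es_state h; set P := es_X g; set Q := es_X h.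
have -> : \sum_k nu_kernel g k * dK k h = cube_sign s t *
    \sum_(C in P) local_coef (circles s) (circles t) diff_coef (P :\ C) Q.
  rewrite -(sum_del1 _ (fun Q' => local_coef (circles s) (circles t) diff_coef Q' Q)) mulr_sumr.
  transitivity (\sum_(k : G | es_state k == s)
     ([&& es_X k \subset P & #|P :\: es_X k| == 1%N]%:R *
      (cube_sign s t * local_coef (circles s) (circles t) diff_coef (es_X k) Q))).
    rewrite [RHS]big_mkcond; apply: eq_bigr => k _;
      rewrite /nu_kernel /cube_kernel -/s -/t -/P -/Q eq_sym.
    by case: eqP => [->|_] //=; rewrite mul0r.
  rewrite (sum_es s (fun X => [&& X \subset P & #|P :\: X| == 1%N]%:R *
      (cube_sign s t * local_coef (circles s) (circles t) diff_coef X Q))).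
  rewrite big_mkcond [RHS]big_mkcond; apply: eq_bigr => X _.
  case: (boolP (X \subset P)) => [XP|_]; last by rewrite mul0r if_same.
  by rewrite (subset_trans XP (es_XP g)) /=; case: eqP; rewrite ?mul1r ?mul0r.
have -> : \sum_k dK g k * nu_kernel k h = cube_sign s t *
    \sum_(C in circles t :\: Q) local_coef (circles s) (circles t) diff_coef P (C |: Q).
  rewrite -(sum_add1 (fun Q' =>
    local_coef (circles s) (circles t) diff_coef P Q') (es_XP h)) mulr_sumr.
  transitivity (\sum_(k : G | es_state k == t)
     ([&& Q \subset es_X k & #|es_X k :\: Q| == 1%N]%:R *
      (cube_sign s t * local_coef (circles s) (circles t) diff_coef P (es_X k)))).
    rewrite [RHS]big_mkcond; apply: eq_bigr => k _;
      rewrite /nu_kernel /cube_kernel -/s -/t -/P -/Q mulrC.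
    by case: eqP => [->|_] //=; rewrite mul0r.
  rewrite (sum_es t (fun X => [&& Q \subset X & #|X :\: Q| == 1%N]%:R *
      (cube_sign s t * local_coef (circles s) (circles t) diff_coef P X))).
  rewrite big_mkcond [RHS]big_mkcond; apply: eq_bigr => X _.
  case: (boolP (X \subset circles t)) => //= Xt.
  by case: ifP; rewrite ?mul1r ?mul0r.
rewrite -mulrBr /cube_kernel -/s -/t -/P -/Q -mulrnAr.
have [->|/cube_sign0[c cs tE]] := eqVneq (cube_sign s t) 0; first by rewrite !mul0r.
congr (_ * _); apply: local_coef_derivation; try exact: es_XP.
by have := surgery_cards cs; rewrite tE.
Qed.

Definition delta_deg g : int := 2 * i_deg g - j_deg g.

Lemma sigmaE s : sigma s = (ncross D)%:Z - (2 * #|s|)%:Z.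
Proof. by rewrite /sigma; have := cardsC s; rewrite card_ord; lia. Qed.

Lemma i_stateU1 s c : c \notin s -> i_state (c |: s) = i_state s + 1.
Proof.
move=> cs; rewrite /i_state !sigmaE cardsU1 cs.
have -> : writhe D - ((ncross D)%:Z - (2 * (true + #|s|))%N%:Z) =
  1 * 2 + (writhe D - ((ncross D)%:Z - (2 * #|s|)%N%:Z)) by lia.
by rewrite divzMDl // addrC.
Qed.

Lemma j_stateE s : j_state s = writhe D + i_state s.
Proof.
rewrite /j_state /i_state -divzMDl //; congr (_ %/ _)%Z; ring.
Qed.

Lemma j_degE g : j_deg g =
  writhe D + i_deg g + (#|circles (es_state g)|%:Z - (2 * #|es_X g|)%:Z).
Proof.
rewrite /j_deg j_stateE; congr (_ + _).
rewrite (bigID (mem (es_X g))) /=.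
under eq_bigr => C /andP[_ ->] do [].
under [X in _ + X]eq_bigr => C /andP[_ /negPf->] do [].
rewrite !sumr_const.
have -> : #|[pred i in circles (es_state g) | i \in es_X g]| = #|es_X g|.
  apply: eq_card => C; rewrite !inE andbC.
  by case: (boolP (C \in es_X g)) => // /(subsetP (es_XP g)).
have -> : #|[pred i in circles (es_state g) | i \notin es_X g]| =
    #|circles (es_state g) :\: es_X g|.
  by apply: eq_card => C; rewrite !inE andbC.
have := cardsD (circles (es_state g)) (es_X g).
rewrite (setIidPr (es_XP g)); have := subset_leq_card (es_XP g).
rewrite -mulr_natr !natz. move: #|_ :\: _| #|es_X g| #|circles _| => a b c. lia.
Qed.

Lemma cube_kernel_neq0 f g h : cube_kernel f g h != 0 -> [/\ exists2 c, c \notin es_state g &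
  es_state h = c |: es_state g, i_deg h = i_deg g + 1 &
  local_coef (circles (es_state g)) (circles (es_state h)) f (es_X g) (es_X h) != 0].
Proof.
rewrite mulf_eq0 negb_or => /andP[/cube_sign0[c cs E] l0]; split=> //; first by exists c.
by rewrite /i_deg E i_stateU1.
Qed.

Lemma diff_kernel_deg g h : dK g h != 0 -> i_deg h = i_deg g + 1 /\ j_deg h = j_deg g.
Proof.
case/cube_kernel_neq0=> -[c cs E] iE l0; split=> //; rewrite !j_degE iE.
have := local_coef_diff_degree (T := _) _ (es_XP g) (es_XP h) l0.
rewrite E => ->; first lia.
exact: surgery_cards.
Qed.

Lemma diff_kernel_delta g h : dK g h != 0 -> delta_deg h = delta_deg g + 2.
Proof. by move=> /diff_kernel_deg[iE jE]; rewrite /delta_deg iE jE; lia. Qed.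

(** T raises i by 1 and j by 2. *)
Lemma turner_kernel_delta g h : TK g h != 0 -> delta_deg h = delta_deg g + 0.
Proof.
case/cube_kernel_neq0=> -[c cs E] iE l0; rewrite /delta_deg !j_degE iE.
have := local_coef_turner_degree (T := _) _ (es_XP g) (es_XP h) l0.
rewrite E => ->; first lia.
exact: surgery_cards.
Qed.

Lemma nu_kernel_neq0 g h : nu_kernel g h != 0 -> [/\ es_state g = es_state h,
  es_X h \subset es_X g & #|es_X g| = #|es_X h|.+1].
Proof.
rewrite /nu_kernel; case: and3P => // -[/eqP E s c1] _; split=> //.
by have := cardsD (es_X g) (es_X h); rewrite (setIidPr s) (eqP c1); lia.
Qed.

Lemma nu_kernel_delta g h : nu_kernel g h != 0 -> delta_deg h = delta_deg g - 2.
Proof.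
case/nu_kernel_neq0=> E _ c1; rewrite /delta_deg !j_degE /i_deg E c1; lia.
Qed.

End Khovanov.

Lemma circles_partition D (s : state D) : partition (circles s) setT.
Proof. by apply: equivalence_partitionP => p q u _ _ _; apply: connect_arc_equiv. Qed.

Lemma circles_trivIset D (s : state D) : trivIset (circles s).
Proof. by have /and3P[] := circles_partition s. Qed.

(** * The subcomplex attached to a base point *)

Section BasePoint.
Variables (D : diagram) (p0 : point D).
Local Notation G := (enhanced_state D).
Local Notation V := {ffun G -> int}.
Implicit Types (s t : state D) (g h : G).

Definition base_circle s := pblock (circles s) p0.

Lemma mem_base_circle s : p0 \in base_circle s.
Proof. by rewrite mem_pblock (cover_partition (circles_partition s)) inE. Qed.

Lemma base_circle_in s : base_circle s \in circles s.
Proof. by rewrite pblock_mem // (cover_partition (circles_partition s)) inE. Qed.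

Lemma base_circle_uniq s C : C \in circles s -> p0 \in C -> C = base_circle s.
Proof. by move=> Cs pC; rewrite /base_circle (def_pblock (circles_trivIset s) Cs pC). Qed.

Definition based : pred G := fun g => base_circle (es_state g) \in es_X g.

(** Both for X^2 = 0 and for X^2 = X the multiples of X form an ideal, and Delta X = X ⊗ X; hence a
    factor X on the circle of the base point survives every surgery. *)
Lemma cube_kernel_based g h : based g ->
  (cube_kernel diff_coef g h != 0 -> based h) /\ (cube_kernel turner_coef g h != 0 -> based h).
Proof.
rewrite /based => gK; have [//|hK] := boolP (base_circle (es_state h) \in es_X h).
suff H : (exists2 c, c \notin es_state g & es_state h = c |: es_state g) ->
    local_coef (circles (es_state g)) (circles (es_state h)) diff_coef (es_X g) (es_X h) = 0 /\
    local_coef (circles (es_state g)) (circles (es_state h)) turner_coef (es_X g) (es_X h) = 0.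
  by split=> /cube_kernel_neq0[/H[d0 t0] _]; rewrite ?d0 ?t0 eqxx.
case=> c cs tE; apply: (@local_coef_base0 _ _ _ _ _ _ (base_circle (es_state g)) (base_circle
  (es_state h))).
- by have := surgery_cards cs; rewrite tE.
- exact: es_XP.
- exact: es_XP.
- exact: gK.
- exact: base_circle_in.
- exact: hK.
have [gt|gt] := boolP (base_circle (es_state g) \in circles (es_state h)).
  by rewrite andbT (base_circle_uniq gt) ?eqxx ?mem_base_circle.
rewrite !inE gt !base_circle_in /= andbT orbC; apply/orP; left; apply: contra gt => ht.
by rewrite -(base_circle_uniq ht) ?mem_base_circle // base_circle_in.
Qed.

Definition mark (b : bool) g : {set {set point D}} :=
  if b then base_circle (es_state g) |: es_X g else es_X g :\ base_circle (es_state g).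

Lemma mark_sub b g : mark b g \subset circles (es_state g).
Proof.
rewrite /mark; case: b; first by rewrite subUset sub1set base_circle_in es_XP.
by apply: subset_trans (es_XP g); apply: subsetDl.
Qed.

Definition with_mark b g : G := @EnhancedState D (es_state g, mark b g) (mark_sub b g).

Lemma based_with_mark b g : based (with_mark b g) = b.
Proof. by rewrite /based /es_X /=; case: b; rewrite !inE eqxx. Qed.

Lemma with_markK b b' g : based g = b -> with_mark b (with_mark b' g) = g.
Proof.
rewrite /based => gb; apply: es_eq => //; change (mark b (with_mark b' g) = es_X g).
rewrite /mark; change (es_state (with_mark b' g)) with (es_state g).
change (es_X (with_mark b' g)) with (mark b' g); rewrite /mark.
by apply/setP=> u; case: b b' gb => -[] gb; rewrite !inE;
  case: (eqVneq u (base_circle (es_state g))) => [->|]; rewrite ?gb.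
Qed.

(** To leave K, nu has to remove the X of the base circle; so nu followed by restriction to the
    unbased generators is a bijection of bases. *)
Lemma nu_kernel_based g h : based g -> ~~ based h -> nu_kernel g h = (g == with_mark true h)%:R.
Proof.
move=> gK hK; have [->|gh] := eqVneq g (with_mark true h).
  rewrite /nu_kernel /es_state /es_X /= -/(es_state h) -/(es_X h) eqxx subsetUr /=.
  rewrite setDUl setDv setU0 (_ : [set _] :\: _ = [set base_circle (es_state h)]) ?cards1 //.
  by apply/setDidPl; rewrite disjoints1.
apply/eqP; apply: contraNT gh => /nu_kernel_neq0[E X c]; apply/eqP/es_eq => //.
rewrite /es_X /= -/(es_X g) -/(es_X h); apply/eqP; rewrite eq_sym eqEcard; apply/andP; split.
  by rewrite subUset X andbT sub1set -E.
by rewrite c cardsU1 hK.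
Qed.

Local Notation nu := (kernel_op (@nu_kernel D)).

Lemma nu_unbased (q : V) h : supported based q -> ~~ based h -> nu q h = q (with_mark true h).
Proof.
move=> qK hK; rewrite ffunE (bigD1 (with_mark true h)) //= big1 => [|g gh].
  by rewrite nu_kernel_based ?based_with_mark // eqxx mulr1 addr0.
have [gK|gK] := boolP (based g); last by rewrite qK ?mul0r.
by rewrite nu_kernel_based // (negPf gh) mulr0.
Qed.

Lemma based_decomposition (c : V) : exists k q, [/\ supported based k,
  supported based q & c = k + nu q].
Proof.
pose q : V := [ffun g => if based g then c (with_mark false g) else 0].
have qK : supported based q by move=> g /negPf gK; rewrite ffunE gK.
exists (c - nu q), q; split=> //; last by rewrite subrK.
move=> h hK; rewrite ffunE [X in _ + X]ffunE nu_unbased // ffunE based_with_mark.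
rewrite with_markK ?subrr //.
exact: negPf.
Qed.

Lemma based_decomposition_uniq (k q : V) :
  supported based k -> supported based q -> k + nu q = 0 -> k = 0 /\ q = 0.
Proof.
move=> kK qK E; suff q0 : q = 0 by move: E; rewrite q0 raddf0 addr0.
apply/ffunP=> g; rewrite [RHS]ffunE; have [gK|/qK//] := boolP (based g).
have := congr1 (fun v : V => v (with_mark false g)) E.
rewrite /= ffunE [RHS]ffunE kK ?based_with_mark // add0r nu_unbased ?based_with_mark //.
by rewrite with_markK.
Qed.

End BasePoint.

(** * The deformed complex in the idempotent basis *)

Section Cube.
Variables (n : nat) (T : finType) (mono : 'I_n -> pred T).
Local Notation state := {set 'I_n}.
Local Notation W := {ffun state * T -> int}.
Implicit Types (s t : state) (c : 'I_n) (w : W).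

Definition crossing_sign t c : int := (-1) ^+ #|[set b in t | (b < c)%N]|.

Lemma crossing_sign_sqr t c : crossing_sign t c * crossing_sign t c = 1.
Proof. by rewrite /crossing_sign -exprD addnn -mul2n exprM sqrrN expr1n. Qed.

Lemma crossing_signD1 t b c : b \in t ->
  crossing_sign (t :\ b) c = crossing_sign t c * (if (b < c)%N then -1 else 1).
Proof.
move=> bt; rewrite /crossing_sign.
have -> : [set a in t :\ b | (a < c)%N] = [set a in t | (a < c)%N] :\ b.
  by apply/setP=> a; rewrite !inE andbA.
rewrite [in RHS](cardsD1 b) inE bt /=; case: ltnP => _; last by rewrite mulr1.
by rewrite add1n exprS; ring.
Qed.

Lemma crossing_sign_self t c : crossing_sign (t :\ c) c = crossing_sign t c.
Proof.
rewrite /crossing_sign; congr (_ ^+ #|pred_of_set _|); apply/setP=> a; rewrite !inE.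
by case: eqP => // ->; rewrite ltnn !andbF.
Qed.

Definition cube_diff w : W :=
  [ffun x : state * T => \sum_(c in x.1 | mono c x.2) crossing_sign x.1 c * w (x.1 :\ c, x.2)].

Lemma cube_diff_is_zmod_morphism : zmod_morphism cube_diff.
Proof.
move=> w w'; apply/ffunP=> x; rewrite !ffunE -sumrB.
by apply: eq_bigr => c _; rewrite !ffunE mulrBr.
Qed.

HB.instance Definition _ :=
  GRing.isZmodMorphism.Build W W cube_diff cube_diff_is_zmod_morphism.

Lemma cube_diff_sqr w : cube_diff (cube_diff w) = 0.
Proof.
apply/ffunP=> -[t F]; rewrite !ffunE /=.
pose a b c : int := if [&& b \in t, c \in t, b != c, mono b F & mono c F] then
  crossing_sign t b * (crossing_sign t c * (if (b < c)%N then -1 else 1)) * w (t :\ b :\ c,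
    F) else 0.
have -> : \sum_(b in t | mono b F) crossing_sign t b * cube_diff w (t :\ b, F) =
    \sum_b \sum_c a b c.
  rewrite big_mkcond; apply: eq_bigr => b _; rewrite ffunE /=.
  case: ifP => [/andP[bt Fb]|bF]; last first.
    rewrite big1 // => c _; rewrite /a.
    by case: and5P => // -[bt _ _ Fb _]; rewrite bt Fb in bF.
  rewrite mulr_sumr big_mkcond; apply: eq_bigr => c _.
  rewrite /a bt Fb /= !inE [c == b]eq_sym crossing_signD1 // mulrA.
  by case: (b == c); case: (c \in t); case: (mono c F).
(* Exchanging the two crossings reverses the sign, so the double sum is its own negative. *)
suff E : \sum_b \sum_c a b c = - \sum_b \sum_c a b c by move: E; lia.
rewrite -sumrN [LHS]exchange_big; apply: eq_bigr => b _; rewrite -sumrN.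
apply: eq_bigr => c _; rewrite /a.
have -> : [&& c \in t, b \in t, c != b, mono c F & mono b F] =
          [&& b \in t, c \in t, b != c, mono b F & mono c F].
  by rewrite eq_sym; case: (c \in t); case: (b \in t); case: eqP; case: (mono c F);
    case: (mono b F).
case: ifP => [/and5P[bt ct bc _ _]|_]; last by rewrite oppr0.
have -> : t :\ c :\ b = t :\ b :\ c by rewrite !setDDl setUC.
by case: (ltngtP b c) bc => [_|_|/val_inj->]; rewrite ?eqxx // => _; ring.
Qed.

(** The contracting homotopy of the cube over [x.2] along one chosen direction; the value 0 applies
    where no direction is available. *)
Definition contract w : W := [ffun x : state * T =>
  (if [pick c | mono c x.2] is Some c then
     if c \in x.1 then 0 else crossing_sign x.1 c * w (c |: x.1, x.2)
   else 0) : int].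

Lemma cube_contraction w s F c0 : [pick c | mono c F] = Some c0 ->
  cube_diff (contract w) (s, F) + contract (cube_diff w) (s, F) = w (s, F).
Proof.
move=> c0E; have c0F : mono c0 F by case: pickP c0E => // c Fc [<-].
rewrite !ffunE /= c0E ffunE /=.
under eq_bigr => c _ do rewrite ffunE /= c0E.
have [c0s|c0s] := boolP (c0 \in s).
  rewrite addr0 (bigD1 c0) ?c0s //= big1 ?addr0 => [|c /andP[_ cc0]].
    by rewrite !inE eqxx /= crossing_sign_self mulrA crossing_sign_sqr mul1r setD1K.
  by rewrite !inE eq_sym cc0 c0s /= mulr0.
rewrite [X in _ + _ * X](bigD1 c0) ?setU11 //=.
rewrite mulrDr mulrA -(crossing_sign_self (c0 |: s) c0) setU1K // crossing_sign_sqr mul1r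
  addrCA.
rewrite mulr_sumr.
have -> : \sum_(c in s | mono c F) crossing_sign s c *
     (if c0 \in s :\ c then 0 else crossing_sign (s :\ c) c0 * w (c0 |: s :\ c, F)) =
   - \sum_(i | (i \in c0 |: s) && mono i F && (i != c0))
      crossing_sign s c0 * (crossing_sign (c0 |: s) i * w ((c0 |: s) :\ i, F)).
  rewrite -sumrN; apply: eq_big => [c|c /andP[cs Fc]].
    by rewrite !inE; case: (eqVneq c c0) => [->|]; rewrite ?(negPf c0s) ?andbF ?andbT.
  have cc0 : c != c0 by apply: contraNneq c0s => <-.
  rewrite !inE (negPf c0s) andbF crossing_signD1 //.
  have -> : (c0 |: s) :\ c = c0 |: s :\ c.
    by apply/setP=> u; rewrite !inE; case: (eqVneq u c0) => [->|]; rewrite // eq_sym cc0.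
  have -> : crossing_sign s c = crossing_sign (c0 |: s) c * (if (c0 < c)%N then -1 else 1).
    by rewrite -crossing_signD1 ?setU11 // setU1K.
  by case: (ltngtP c c0) cc0 => [_|_|/val_inj->]; rewrite ?eqxx // => _; ring.
by rewrite addNr addr0.
Qed.

(** The complex splits over F. If F has a direction, its cube is contractible; otherwise the
    differential vanishes over F, and 2 u = 0 forces u = 0 there. *)
Lemma cube_torsion_free u y : u *+ 2 = cube_diff y -> u = cube_diff (contract u).
Proof.
move=> E; have du : cube_diff u = 0.
  by apply: (@ffun_mulIn _ 1); rewrite -(raddfMn cube_diff) E /= cube_diff_sqr mul0rn.
apply/ffunP=> -[s F]; case c0E : [pick c | mono c F] => [c0|].
  by rewrite -(cube_contraction u s c0E) du [X in _ + X]ffunE c0E; case: ifP => _;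
    rewrite ?ffunE ?mulr0 addr0.
have none c : mono c F = false by case: pickP c0E.
have d0 w : cube_diff w (s, F) = 0.
  by rewrite ffunE big_pred0 // => c; rewrite none andbF.
rewrite d0; have := congr1 (fun v : W => v (s, F)) E.
rewrite /= d0 ffunMnE => /eqP; rewrite mulrn_eq0 /= => /eqP //.
Qed.

End Cube.

(** * Idempotent tensors and their behaviour under a surgery *)

Section Colorings.
Variable D : diagram.
Local Notation G := (enhanced_state D).
Local Notation pts := {set point D}.
Implicit Types (s t : state D) (g h : G) (F C : pts) (c : 'I_(ncross D)).

(* An idempotent basis tensor, with X on some circles and 1 - X on the others, is
   encoded by its state and by the union [F] of the circles carrying X. *)
Definition union_of_circles s F :=
  [forall C in circles s, (C \subset F) || [disjoint C & F]].

Definition inner s F : {set pts} := [set C in circles s | C \subset F].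

(** For X^2 = X the product of X and 1 - X is 0, and Delta maps X and 1 - X to plus or minus their
    own tensor squares. So an edge is nonzero on the tensor of F only if all strands at the crossing
    agree, and then it keeps F: each F spans a cube of its own. *)
Definition mono c F := [forall k, (crossing_end c k \in F) == (crossing_end c 0 \in F)].

Lemma unionP s F : reflect (forall C, C \in circles s -> C \subset F \/ [disjoint C & F])
  (union_of_circles s F).
Proof.
by apply: (iffP forall_inP) => H C /H; [move/orP | move=> ?; apply/orP].
Qed.

Lemma circle_neq0 s C : C \in circles s -> C != set0.
Proof.
have /and3P[_ _ n0] := circles_partition s.
by apply: contraTneq => ->.
Qed.

Lemma circle_meets s F C p : union_of_circles s F -> C \in circles s -> p \in C -> p \in F ->
  C \subset F.
Proof. by move=> /unionP H /H[//|/disjointFr H'] pC pF; rewrite H' in pF. Qed.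

Lemma inner_sub s F : inner s F \subset circles s.
Proof. by apply/subsetP=> C; rewrite inE => /andP[]. Qed.

Lemma cover_inner s F : union_of_circles s F -> cover (inner s F) = F.
Proof.
move=> cF; apply/setP=> p; apply/bigcupP/idP => [[C]|pF].
  by rewrite inE => /andP[_ /subsetP CF] /CF.
exists (base_circle p s); last exact: mem_base_circle.
rewrite inE base_circle_in.
exact: circle_meets cF (base_circle_in _ _) (mem_base_circle _ _) pF.
Qed.

Lemma cover_union s (E : {set pts}) : E \subset circles s -> union_of_circles s (cover E).
Proof.
move=> Es; apply/unionP=> C Cs.
have [CE|CE] := boolP (C \in E); [left; exact: bigcup_sup | right].
rewrite -setI_eq0; apply/eqP/setP=> p; rewrite !inE;
  apply/negP=> /andP[pC /bigcupP[C' C'E pC']].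
case/negP: CE; rewrite (base_circle_uniq Cs pC).
by rewrite -(base_circle_uniq (subsetP Es _ C'E) pC').
Qed.

Lemma inner_cover s (E : {set pts}) : E \subset circles s -> inner s (cover E) = E.
Proof.
move=> Es; apply/setP=> C; rewrite inE; apply/andP/idP => [[Cs CE]|CE].
  have /set0Pn[p pC] := circle_neq0 Cs.
  have /bigcupP[C' C'E pC'] := subsetP CE _ pC.
  by rewrite (base_circle_uniq Cs pC) -(base_circle_uniq (subsetP Es _ C'E) pC').
by rewrite (subsetP Es) //; split=> //; apply: bigcup_sup.
Qed.

Lemma sum_unions s (phi : {set pts} -> int) :
  \sum_(F | union_of_circles s F) phi (inner s F) =
  \sum_(E : {set pts} | E \subset circles s) phi E.
Proof.
rewrite (reindex_onto (fun E => cover E) (inner s)) /=; last by move=> F; apply: cover_inner.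
apply: eq_big => [E|E /andP[_ /eqP ->//]].
apply/andP/idP => [[_ /eqP <-]|Es]; first exact: inner_sub.
by rewrite cover_union ?inner_cover.
Qed.

Lemma union_arc s F : reflect (forall p q, arc s p q -> (p \in F) =
  (q \in F)) (union_of_circles s F).
Proof.
apply: (iffP (unionP s F)) => [H p q pq|H C /imsetP[p _ ->]].
  have cF : union_of_circles s F by apply/unionP.
  have E : base_circle q s = base_circle p s.
    apply/esym/base_circle_uniq; first exact: base_circle_in.
    rewrite /base_circle pblock_equivalence_partition ?inE // ?connect1 //.
    by move=> u v w _ _ _; apply: connect_arc_equiv.
  apply/idP/idP => pF.
    apply: (subsetP (circle_meets cF (base_circle_in p s) (mem_base_circle p s) pF)).
    by rewrite -E mem_base_circle.
  apply: (subsetP (circle_meets cF (base_circle_in q s) (mem_base_circle q s) pF)).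
  by rewrite E mem_base_circle.
have {}H q : connect (arc s) p q -> (p \in F) = (q \in F).
  by apply: (@closed_connect _ _ (mem F)) => u v; apply: H.
have [pF|pF] := boolP (p \in F); [left|right].
  by apply/subsetP=> q; rewrite !inE /= => /H <-.
rewrite -setI_eq0; apply/eqP/setP=> q; rewrite !inE /=; apply/negP=> /andP[/H <-].
exact/negP.
Qed.

Lemma monoP c F : reflect (forall k k', (crossing_end c k \in F) =
  (crossing_end c k' \in F)) (mono c F).
Proof.
apply: (iffP forallP) => [H k k'|H k]; last exact/eqP.
by rewrite (eqP (H k)) (eqP (H k')).
Qed.

Lemma mono_union_same s t c F : same_but s t c -> mono c F -> union_of_circles s F ->
  union_of_circles t F.
Proof.
move=> st /monoP cF /union_arc sF; apply/union_arc => -[x|i] [y|j] //= /orP[]/eqP->.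
  by apply: sF; rewrite /= eqxx.
have [xc|xc] := eqVneq x.1 c.
  by case: x xc => a k /= ->; apply: cF.
by apply: sF; rewrite /= -(st _ xc) eqxx orbT.
Qed.

Lemma same_but_setU1 s c : same_but (c |: s) s c.
Proof. by move=> x xc; apply: smooth_other. Qed.

Lemma mono_unionE s c F : mono c F -> union_of_circles (c |: s) F = union_of_circles s F.
Proof.
move=> cF; apply/idP/idP; apply: mono_union_same cF; first exact: same_but_setU1.
by move=> x xc; rewrite same_but_setU1.
Qed.

(* Since Delta(1 - X) = - (1 - X) ⊗ (1 - X), the idempotents are rescaled by
   [weight_sign]: [weight] grows by 2 when a circle carrying 1 - X is split and
   is constant along all other edges. *)
Definition weight s F : nat :=
  (#|circles s :\: inner s F| + #|[set c in s | crossing_end c 0%R \notin F]|)%N.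

Definition weight_sign s F : int := (-1) ^+ (weight s F)./2.

Lemma weight_sign_sqr s F : weight_sign s F * weight_sign s F = 1.
Proof. by rewrite /weight_sign -exprD addnn -mul2n exprM sqrrN expr1n. Qed.

Lemma weightU1 s c F : c \notin s ->
  (weight (c |: s) F + #|old s (c |: s) :\: inner s F| =
   weight s F + #|old (c |: s) s :\: inner (c |: s) F| + (crossing_end c 0%R \notin F))%N.
Proof.
move=> cs; set t := c |: s.
have split s' t' : #|circles s' :\: inner s' F| =
    (#|[set C in circles s' :&: circles t' | ~~ (C \subset F)]| + #|old s' t' :\: inner s'
      F|)%N.
  rewrite -(cardsID (circles t') (_ :\: inner s' F)); congr addn; apply: eq_card => C;
    rewrite !inE.
    by case: (C \in circles s'); case: (C \in circles t'); case: (C \subset F).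
  by case: (C \in circles s'); case: (C \in circles t'); case: (C \subset F).
have cr : #|[set b in t | crossing_end b 0%R \notin F]| =
    ((crossing_end c 0%R \notin F) + #|[set b in s | crossing_end b 0%R \notin F]|)%N.
  rewrite (cardsD1 c) !inE eqxx /=; congr addn; apply: eq_card => b; rewrite !inE.
  by case: (eqVneq b c) => [->|//]; rewrite (negPf cs).
rewrite /weight (split s t) (split t s) cr setIC; lia.
Qed.

Definition deformed_coef o x y : int := diff_coef o x y + turner_coef o x y.

Lemma inner_surgery s t (P : {set pts}) F : P \subset circles s ->
  (P \subset inner s F) = (P :\: old s t \subset inner t F) && (P :&: old s t \subset inner s
    F).
Proof.
move=> Ps; apply/idP/andP => [PF|[Pin1 Pin2]].
  split; last by apply: subset_trans PF; apply: subsetIl.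
  apply/subsetP=> C; rewrite !inE => /andP[Co CP].
  have := subsetP PF _ CP; rewrite inE => /andP[Cs ->]; rewrite andbT.
  by rewrite Cs andbT negbK in Co.
apply/subsetP=> C CP; have [Co|Co] := boolP (C \in old s t).
  by apply: (subsetP Pin2); rewrite inE CP.
have := subsetP Pin1 C; rewrite in_setD Co CP !inE => /(_ isT)/andP[_ ->].
by rewrite (subsetP Ps).
Qed.

Lemma inner_all s (A : {set pts}) F : A \subset circles s -> (forall C, C \in A ->
  C \subset F) ->
  [/\ A \subset inner s F, #|inner s F :&: A| = #|A| & #|A :\: inner s F| = 0%N].
Proof.
move=> As AF; have AI : A \subset inner s F.
  by apply/subsetP=> C CA; rewrite inE (subsetP As) ?AF.
by rewrite AI (setIidPr AI) (eqP (_ : A :\: inner s F == set0)) ?cards0 // setD_eq0.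
Qed.

Lemma inner_none s (A : {set pts}) F : (forall C, C \in A -> ~~ (C \subset F)) ->
  #|inner s F :&: A| = 0%N /\ #|A :\: inner s F| = #|A|.
Proof.
move=> AF; have AI : inner s F :&: A = set0.
  by apply/setP=> C; rewrite !inE; case: (boolP (C \in A)) => [/AF/negPf->|_]; rewrite ?andbF.
by rewrite AI cards0 cardsD setIC AI cards0 subn0.
Qed.

Lemma weight_sign_add2 s t F : weight t F = (weight s F).+2 -> weight_sign t F =
  - weight_sign s F.
Proof. by rewrite /weight_sign => -> /=; rewrite exprS mulN1r. Qed.

(** Up to [weight_sign], the sum is the F-coordinate of the deformed edge map on the tensor with X
    on P. It equals the F-coordinate of that tensor itself if the crossing is monochromatic, and 0
    otherwise. *)
Lemma surgery_identity s c (P : {set pts}) F : c \notin s -> P \subset circles s ->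
  let t := c |: s in
  (if union_of_circles t F then
     weight_sign t F * \sum_(Q : {set pts} | Q \subset inner t F) local_coef (circles s)
       (circles t) deformed_coef P Q
   else 0) =
  (if [&& mono c F, union_of_circles s F & P \subset inner s F] then weight_sign s F else 0).
Proof.
move=> cs Ps t; case: (boolP (union_of_circles t F)) => tF; last first.
  by case: (boolP (mono c F)) => //= cF; rewrite -(mono_unionE s cF) (negPf tF).
rewrite (sum_loc deformed_coef Ps (inner_sub t F)) -/(old s t) -/(old t s).
rewrite (inner_surgery t F Ps).
case: (boolP (P :\: old s t \subset inner t F)) => PF; last by rewrite mulr0 /= !andbF.
rewrite /=; have W := weightU1 F cs; rewrite -/t in W.
have xo : (#|P :&: old s t| <= #|old s t|)%N by rewrite subset_leq_card ?subsetIr.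
have [C1 [C2 [c12 ends surg]]] := surgery_circles cs;
  rewrite -/t -/(old s t) -/(old t s) in surg.
have os : old s t \subset circles s by apply: subsetDl.
have nt : old t s \subset circles t by apply: subsetDl.
have sumE f (phi : nat -> int) : \sum_(k < f.+1) phi k *+ 'C(f, k) =
   if f is 0 then phi 0%N else if f is 1 then phi 0%N + phi 1%N
   else if f is 2 then phi 0%N + phi 1%N *+ 2 + phi 2%N else \sum_(k < f.+1) phi k *+ 'C(f, k).
  case: f => [|[|[|//]]]; rewrite !big_ord_recl big_ord0 /= !addr0 //.
  by rewrite addrA.
have sFE : mono c F -> union_of_circles s F by move/(mono_unionE s) => <-.
clearbody t.
have all_in : (C1 \subset F) -> C2 \subset F ->
  [/\ mono c F, crossing_end c 0 \in F, forall C, C \in old s t -> C \subset F &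
      forall C, C \in old t s -> C \subset F].
  move=> in1 in2; have in12 : C1 :|: C2 \subset F by rewrite subUset in1.
  split; try by case: surg => -[oE nE] C; rewrite ?oE ?nE !inE; try case/orP; move=> /eqP->.
    by apply/monoP=> k k'; rewrite !(subsetP in12).
  exact: subsetP in12 _ (ends 0).
have all_out : [disjoint C1 & F] -> [disjoint C2 & F] ->
  [/\ mono c F, crossing_end c 0 \notin F, forall C, C \in old s t -> ~~ (C \subset F) &
      forall C, C \in old t s -> ~~ (C \subset F)].
  move=> in1 in2; have in12 : [disjoint C1 :|: C2 & F] by rewrite !disjoints_subset subUset
    in in1 in2 *; rewrite in1.
  have out s' C : C \in circles s' -> [disjoint C & F] -> ~~ (C \subset F).
    move=> /circle_neq0/set0Pn[p pC] CF; apply/subsetPn; exists p => //.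
    by rewrite (disjointFr CF).
  have oo C : C \in old s t -> [disjoint C & F] -> ~~ (C \subset F).
    by move=> Co; apply/out/(subsetP os).
  have oo' C : C \in old t s -> [disjoint C & F] -> ~~ (C \subset F).
    by move=> Co; apply/out/(subsetP nt).
  split.
  - by apply/monoP=> k k'; rewrite !(disjointFr in12).
  - by rewrite (disjointFr in12).
  - move=> C Co; apply: oo (Co) _; move: Co.
    by case: surg => -[oE nE]; rewrite ?oE ?nE !inE; try case/orP; move=> /eqP->.
  - move=> C Co; apply: oo' (Co) _; move: Co.
    by case: surg => -[oE nE]; rewrite ?oE ?nE !inE; try case/orP; move=> /eqP->.
have xP : (P :&: old s t == set0) = (#|P :&: old s t| == 0)%N by rewrite cards_eq0.
have subF : (forall C, C \in old s t -> ~~ (C \subset F)) ->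
    (P :&: old s t \subset inner s F) = (#|P :&: old s t| == 0%N).
  move=> oF; rewrite -xP; apply/idP/eqP => [PI|->]; last exact: sub0set.
  apply/setP=> C; rewrite !inE; apply/negP=> /andP[CP]; rewrite -in_setD => Co.
  have := subsetP PI C; rewrite in_setI CP Co inE => /(_ isT)/andP[_].
  exact/negP/oF.
have split_out C C' : C1 :|: C2 \in circles s -> C \in old t s -> C' \in old t s ->
    C \subset F -> [disjoint C' & F] ->
    C1 :|: C2 = C :|: C' -> mono c F = false.
  move=> C12s Cn C'n CF C'F E; apply/negP=> /sFE sF.
  have [p pC] := set0Pn _ (circle_neq0 (subsetP nt _ Cn)).
  have [q qC] := set0Pn _ (circle_neq0 (subsetP nt _ C'n)).
  have : C1 :|: C2 \subset F.
    by apply: (circle_meets sF C12s _ (subsetP CF _ pC)); rewrite E inE pC.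
  by move=> /subsetP/(_ q); rewrite E inE qC orbT => /(_ isT); rewrite (disjointFr C'F).
move: W; move Eo: #|old s t| xo => o xo.
move Ex: #|P :&: old s t| xo subF => x xo subF.
move Ef: #|inner t F :&: old t s| => f.
move Ea: #|old s t :\: inner s F| => a.
move Eb: #|old t s :\: inner t F| => b W.
case: surg => -[oE nE].
  have [in12|in12] : (C1 :|: C2 \subset F) \/ [disjoint C1 :|: C2 & F].
    by apply: (unionP _ _ tF); rewrite (subsetP nt) // nE inE.
    move: in12; rewrite subUset => /andP[in1 in2].
    have [cF c0F oF nF] := all_in in1 in2.
    have [AI1 _ A1] := inner_all os oF; have [_ B1 B2] := inner_all nt nF.
    have sF := sFE cF; rewrite cF sF (subset_trans (subsetIr _ _) AI1).
    move: W xo; rewrite -Ea A1 -Eb B2 -Ef B1 -Eo oE nE cards1 cards2 c12 c0F /=.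
    rewrite !addn0 sumE /weight_sign => ->.
    by case: (x) => [|[|[|//]]] _; rewrite mulr1.
  move: in12; rewrite disjoints_subset subUset -!disjoints_subset => /andP[in1 in2].
  have [cF c0F oF nF] := all_out in1 in2.
  have [_ A1] := inner_none s oF; have [B1 B2] := inner_none t nF.
  have sF := sFE cF; rewrite cF sF (subF oF).
  move: W xo; rewrite -Ea A1 -Eb B2 -Ef B1 -Eo oE nE cards1 cards2 c12 c0F /=.
  rewrite sumE addn2 !addn1 => -[Wt]; rewrite /weight_sign Wt.
  by case: (x) => [|[|[|//]]] _; rewrite ?mulr1 ?mulr0.
have C1n : C1 \in old t s by rewrite nE !inE eqxx.
have C2n : C2 \in old t s by rewrite nE !inE eqxx orbT.
have C12s : C1 :|: C2 \in circles s by rewrite (subsetP os) // oE inE.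
(* When a split separates F from its complement, the new coefficients 1 and -1 in Delta 1 = ... - 1
   ⊗ 1 cancel, and Delta X does not contribute. *)
have mixed C C' : old t s = [set C; C'] -> C \subset F -> ~~ (C' \subset F) ->
    mono c F = false -> weight_sign t F * \sum_(k < f.+1) deformed_coef o x k *+ 'C(f, k) = 0.
  move=> E CF C'F _; have f1 : f = 1%N.
    rewrite -Ef; apply/eqP/cards1P; exists C; apply/setP=> B.
    rewrite in_setI E [LHS]andbC in_set2 in_set1.
    have [->|BC] /= := eqVneq B C; first by rewrite inE CF (subsetP nt) // E set21.
    by case: eqP => //= ->; rewrite inE (negPf C'F) andbF.
  move: xo; rewrite -Eo oE cards1 f1 sumE.
  by case: (x) => [|[|//]] _; rewrite mulr0.
have not_sub C : C \in old t s -> [disjoint C & F] -> ~~ (C \subset F).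
  move=> /(subsetP nt)/circle_neq0/set0Pn[p pC] CF; apply/subsetPn; exists p => //.
  by rewrite (disjointFr CF).
have [in1|in1] : C1 \subset F \/ [disjoint C1 & F].
- by apply: (unionP _ _ tF); rewrite (subsetP nt).
- have [in2|in2] : C2 \subset F \/ [disjoint C2 & F].
  + by apply: (unionP _ _ tF); rewrite (subsetP nt).
  + have [cF c0F oF nF] := all_in in1 in2.
    have [AI1 _ A1] := inner_all os oF; have [_ B1 B2] := inner_all nt nF.
    have sF := sFE cF; rewrite cF sF (subset_trans (subsetIr _ _) AI1).
    move: W xo; rewrite -Ea A1 -Eb B2 -Ef B1 -Eo oE nE cards1 cards2 c12 c0F /=.
    rewrite !addn0 sumE /weight_sign => ->.
    by case: (x) => [|[|//]] _; rewrite mulr1.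
  have cF : mono c F = false by apply: split_out in1 in2 _.
  by rewrite (mixed C1 C2) ?cF ?not_sub.
have [in2|in2] : C2 \subset F \/ [disjoint C2 & F].
- by apply: (unionP _ _ tF); rewrite (subsetP nt).
- have cF : mono c F = false by apply: split_out in2 in1 _; rewrite // setUC.
  by rewrite (mixed C2 C1) ?cF ?not_sub // setUC.
have [cF c0F oF nF] := all_out in1 in2.
have [_ A1] := inner_none s oF; have [B1 B2] := inner_none t nF.
have sF := sFE cF; rewrite cF sF (subF oF).
move: W xo; rewrite -Ea A1 -Eb B2 -Ef B1 -Eo oE nE cards1 cards2 c12 c0F /=.
(* The split of a circle carrying 1 - X has coefficient -1, which the change of [weight_sign]
   compensates. *)
rewrite sumE addn2 !addn1 => -[Wt]; rewrite (weight_sign_add2 Wt).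
by case: (x) => [|[|//]] _; rewrite /deformed_coef /diff_coef /turner_coef /=; ring.
Qed.

End Colorings.

(** * The change to the idempotent basis *)

Section Idempotents.
Variable D : diagram.
Local Notation G := (enhanced_state D).
Local Notation pts := {set point D}.
Local Notation V := {ffun G -> int}.
Local Notation W := {ffun state D * pts -> int}.
Implicit Types (s t : state D) (g h : G) (F C : pts) (c : 'I_(ncross D)) (v : V) (w : W).

Local Notation DK := (cube_kernel (deformed_coef)).
Local Notation cdiff := (cube_diff (@mono D)).

(** As 1 = X + (1 - X), the tensor with X on P is the sum of the idempotent tensors whose X-circles
    contain P. *)
Definition to_idem v : W := [ffun x : state D * pts =>
  (if union_of_circles x.1 x.2 then
    weight_sign x.1 x.2 * \sum_(g : G | (es_state g == x.1) && (es_X g \subset inner x.1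
      x.2)) v g
  else 0) : int].

(** The inverse by Moebius inversion: the factors 1 - X are expanded with alternating signs. *)
Definition of_idem w : V := [ffun g : G =>
  \sum_(F | union_of_circles (es_state g) F && (inner (es_state g) F \subset es_X g))
    (-1) ^+ (#|es_X g| + #|inner (es_state g) F|) * weight_sign (es_state g) F * w (es_state
      g, F)].

Lemma moebius_between (X Y : {set pts}) :
  \sum_(E : {set pts} | (X \subset E) && (E \subset Y)) (-1) ^+ (#|Y| + #|E|) =
    (X == Y)%:R :> int.
Proof.
under eq_bigr do rewrite exprD.
rewrite -mulr_sumr moebius_subsets; case: eqP => [->|_]; last by rewrite mulr0.
by rewrite mulr1n -exprD addnn -mul2n exprM sqrrN expr1n.
Qed.

Lemma moebius_between_left (X Y : {set pts}) :
  \sum_(E : {set pts} | (X \subset E) && (E \subset Y)) (-1) ^+ (#|E| + #|X|) =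
    (X == Y)%:R :> int.
Proof.
under eq_bigr do rewrite addnC exprD.
rewrite -mulr_sumr moebius_subsets; case: eqP => [->|_]; last by rewrite mulr0.
by rewrite mulr1n -exprD addnn -mul2n exprM sqrrN expr1n.
Qed.

Lemma to_idemK : cancel to_idem of_idem.
Proof.
move=> v; apply/ffunP=> g; rewrite ffunE; set s := es_state g.
transitivity (\sum_(k : G | es_state k == s) v k * (es_X k == es_X g)%:R); last first.
  rewrite (bigD1 g) ?eqxx //= ?eqxx mulr1 big1 ?addr0 // => k /andP[/eqP sk kg].
  by case: eqP => [E|_]; rewrite ?mulr0 //; case/eqP: kg; apply: es_eq.
transitivity (\sum_(E : {set pts}) \sum_(k : G | es_state k == s)
  if (es_X k \subset E) && (E \subset es_X g) then (-1) ^+ (#|es_X g| + #|E|) * v k else 0);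
    last first.
  rewrite exchange_big; apply: eq_bigr => k _.
  by rewrite -big_mkcond -mulr_suml moebius_between mulrC.
pose phi (E : {set pts}) : int := if E \subset es_X g then (-1) ^+ (#|es_X g| + #|E|) *
   \sum_(k : G | (es_state k == s) && (es_X k \subset E)) v k else 0.
transitivity (\sum_(F | union_of_circles s F) phi (inner s F)).
  rewrite big_mkcondr; apply: eq_bigr => F sF; rewrite /phi; case: ifP => // _.
  by rewrite ffunE /= sF -mulrA; congr (_ * _); rewrite mulrA weight_sign_sqr mul1r.
rewrite sum_unions big_mkcond; apply: eq_bigr => E _; rewrite /phi.
case: (boolP (E \subset es_X g)) => [Eg|Eg]; last first.
  by rewrite if_same big1 // => k _; rewrite andbF.
rewrite (subset_trans Eg (es_XP g)) mulr_sumr big_mkcondr; apply: eq_bigr => k _.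
by rewrite andbT.
Qed.

Lemma of_idemK w : (forall s F, ~~ union_of_circles s F -> w (s, F) = 0) ->
  to_idem (of_idem w) = w.
Proof.
move=> w0; apply/ffunP=> -[t F]; rewrite ffunE /=; case: ifPn => [tF|/w0->//].
pose a (E : {set pts}) : int := \sum_(F' | union_of_circles t F')
  if (inner t F' \subset E) && (E \subset inner t F) then
    (-1) ^+ (#|E| + #|inner t F'|) * (weight_sign t F' * w (t, F')) else 0.
transitivity (weight_sign t F * \sum_(E : {set pts} | E \subset circles t) a E).
  congr (_ * _); rewrite -sum_es big_mkcondr; apply: eq_bigr => g /eqP gt.
  rewrite /a; case: ifP => gF; last by rewrite big1 // => F' _; rewrite andbF.
  rewrite ffunE gt big_mkcondr; apply: eq_bigr => F' _; rewrite andbT.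
  by case: ifP; rewrite ?mulrA.
have inner_inj F' : union_of_circles t F' -> (inner t F' == inner t F) = (F' == F).
  move=> tF'; apply/eqP/eqP => [E|->//].
  by rewrite -(cover_inner tF') E cover_inner.
transitivity (weight_sign t F * \sum_(F' | union_of_circles t F')
    (inner t F' == inner t F)%:R * (weight_sign t F' * w (t, F'))).
  congr (_ * _); rewrite /a exchange_big; apply: eq_bigr => F' tF'.
  rewrite -moebius_between_left mulr_suml [RHS]big_mkcond [LHS]big_mkcond.
  apply: eq_bigr => E _; case: (boolP (E \subset inner t F)) => EF;
    last by rewrite andbF if_same.
  by rewrite (subset_trans EF (inner_sub _ _)) andbT.
rewrite (bigD1 F) //= big1 ?addr0 => [|F' /andP[tF' /negPf FF']].
  by rewrite eqxx mul1r mulrA weight_sign_sqr mul1r.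
by rewrite inner_inj // FF' mul0r.
Qed.

Lemma to_idem_is_zmod_morphism : zmod_morphism to_idem.
Proof.
move=> v v'; apply/ffunP=> x; rewrite !ffunE; case: ifP => _; last by rewrite subr0.
rewrite -mulrBr -sumrB; congr (_ * _); apply: eq_bigr => g _.
by rewrite !ffunE.
Qed.

HB.instance Definition _ :=
  GRing.isZmodMorphism.Build V W to_idem to_idem_is_zmod_morphism.

Lemma sum_ker g t F :
  \sum_(h : G | (es_state h == t) && (es_X h \subset inner t F)) DK g h =
  cube_sign (es_state g) t * \sum_(Q : {set pts} | Q \subset inner t F)
    local_coef (circles (es_state g)) (circles t) deformed_coef (es_X g) Q.
Proof.
pose phi (Q : {set pts}) : int := if Q \subset inner t F then cube_sign (es_state g) t *
    local_coef (circles (es_state g)) (circles t) deformed_coef (es_X g) Q else 0.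
transitivity (\sum_(h : G | es_state h == t) phi (es_X h)).
  rewrite big_mkcondr.
  apply: eq_bigr => h /eqP ht.
  rewrite /phi.
  rewrite /cube_kernel ht.
  by [].
rewrite sum_es mulr_sumr big_mkcond [RHS]big_mkcond; apply: eq_bigr => Q _; rewrite /phi.
by case: (boolP (Q \subset inner t F)) => [QF|];
  rewrite ?if_same ?(subset_trans QF (inner_sub _ _)).
Qed.

Lemma to_idem_kop v : to_idem (kernel_op DK v) = cdiff (to_idem v).
Proof.
apply/ffunP=> -[t F]; rewrite !ffunE /=.
transitivity (\sum_g v g * (if union_of_circles t F then weight_sign t F *
    \sum_(h : G | (es_state h == t) && (es_X h \subset inner t F)) DK g h else 0)).
  case: ifP => _; last by rewrite big1 // => g _; rewrite mulr0.
  under eq_bigr => h _ do rewrite ffunE.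
  rewrite exchange_big mulr_sumr; apply: eq_bigr => g _.
  by rewrite [RHS]mulrCA; congr (_ * _); rewrite mulr_sumr.
transitivity (\sum_g v g * \sum_(c in t | mono c F) crossing_sign t c *
    (if [&& es_state g == t :\ c, union_of_circles (es_state g) F
       & es_X g \subset inner (es_state g) F] then weight_sign (es_state g) F else 0));
         last first.
  under [LHS]eq_bigr => g _ do rewrite mulr_sumr.
  rewrite exchange_big; apply: eq_bigr => c _; rewrite ffunE /=.
  transitivity (\sum_(g : G | es_state g == t :\ c) v g * (crossing_sign t c *
    (if union_of_circles (t :\ c) F && (es_X g \subset inner (t :\ c) F) then
       weight_sign (t :\ c) F else 0))).
    rewrite [RHS]big_mkcond; apply: eq_bigr => g _.
    by case: eqP => [->|_] //=; rewrite !mulr0.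
  case: (union_of_circles (t :\ c) F) => /=; last first.
    by transitivity (0 : int); [apply: big1 => g _; rewrite mulr0 mulr0 | apply/esym/mulr0].
  rewrite big_mkcondr !mulr_sumr; apply: eq_bigr => g _ /=.
  by case: ifP => _; rewrite ?mulr0 // mulrC mulrA.
apply: eq_bigr => g _; congr (_ * _); rewrite sum_ker; set s := es_state g.
have [c /andP[ct /eqP sE]|none] := pickP (fun c => (c \in t) && (s == t :\ c)).
  have cs : c \notin s by rewrite sE !inE eqxx.
  have tE : t = c |: s by rewrite sE setD1K.
  rewrite tE; have := surgery_identity F cs (es_XP g); rewrite /= => E.
  transitivity (cube_sign s (c |: s) * (if [&& mono c F, union_of_circles s F
      & es_X g \subset inner s F] then weight_sign s F else 0)).
    rewrite -E; case: ifP => _; last by rewrite mulr0.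
    by rewrite mulrCA.
  have uniq c' : c' \in c |: s -> s == (c |: s) :\ c' -> c' = c.
    rewrite !inE => /orP[/eqP//|c's] /eqP/setP/(_ c').
    by rewrite !inE c's eqxx.
  rewrite cube_signU1 // -/(crossing_sign s c) -{1}(setU1K cs) crossing_sign_self.
  case: (boolP (mono c F)) => cF /=; last first.
    rewrite mulr0 big1 // => c' /andP[c't c'F].
    case: eqP => [/eqP/(uniq c' c't) c'c|_] /=; last by rewrite mulr0.
    by rewrite c'c (negPf cF) in c'F.
  rewrite (bigD1 c) ?setU11 //= setU1K // eqxx big1 ?addr0 // => c' /andP[/andP[c't _] c'c].
  case: eqP => [/eqP/(uniq c' c't) c'c'|_] /=; last by rewrite mulr0.
  by rewrite c'c' eqxx in c'c.
rewrite [RHS]big1 => [|c /andP[ct _]]; last first.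
  by have := none c; rewrite ct /= => ->; rewrite mulr0.
have -> : cube_sign s t = 0.
  apply/eqP/negPn/negP => /cube_sign0[c cs tE].
  by have := none c; rewrite tE setU11 setU1K ?eqxx.
by rewrite mul0r mulr0 if_same.
Qed.

Lemma deformed_diff_sqr v : kernel_op DK (kernel_op DK v) = 0.
Proof.
apply: (can_inj to_idemK); rewrite !to_idem_kop cube_diff_sqr.
by rewrite raddf0.
Qed.

(** Membership in K means that the idempotent coordinates vanish for all F avoiding the base point.
    The contraction does not change F, so it produces a primitive in K. *)
Lemma deformed_torsion_free (p0 : point D) (y z : V) : supported (based p0) z ->
  z *+ 2 = kernel_op DK y -> exists2 p, supported (based p0) p & z = kernel_op DK p.
Proof.
move=> zK E; pose u := to_idem z; pose w := contract (@mono D) u.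
have uE : u = cdiff w.
  by apply: (@cube_torsion_free _ _ _ _ (to_idem y));
    rewrite -(raddfMn to_idem) E /= to_idem_kop.
have w0 s F : ~~ union_of_circles s F -> w (s, F) = 0.
  move=> sF; rewrite ffunE /=; case: pickP => [c cF|//]; case: ifP => // cs.
  by rewrite /u ffunE /= mono_unionE // (negPf sF) mulr0.
exists (of_idem w).
  move=> g gK; rewrite ffunE big1 // => F /andP[sF FX].
  suff -> : w (es_state g, F) = 0 by rewrite mulr0.
  have pF : p0 \notin F.
    apply: contra gK => pF; rewrite /based (subsetP FX) // inE base_circle_in.
    exact: circle_meets sF (base_circle_in _ _) (mem_base_circle _ _) pF.
  rewrite ffunE /=; case: pickP => [c cF|//]; case: ifP => // cs.
  suff -> : u (c |: es_state g, F) = 0 by rewrite mulr0.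
  rewrite ffunE /=; case: ifP => // tF; rewrite big1 ?mulr0 // => k /andP[/eqP kt kF].
  apply: zK; rewrite /based; apply: contra pF => /(subsetP kF).
  by rewrite inE => /andP[_ /subsetP]; apply; apply: mem_base_circle.
by apply: (can_inj to_idemK); rewrite to_idem_kop of_idemK.
Qed.

End Idempotents.

Lemma mulrn_coprime (V : zmodType) (y : V) a b :
  coprime a b -> y *+ a = 0 -> y *+ b = 0 -> y = 0.
Proof.
case: a => [|a]; first by rewrite /coprime gcd0n => /eqP-> _ /=.
move=> ab ya yb; have [m _ /dvdnP[n E]] := Bezoutl b (ltn0Sn a).
rewrite (eqP ab) in E.
have : y *+ (1 + m * b) = 0 by rewrite E mulnC mulrnA ya mul0rn.
by rewrite mulrnDr mulnC mulrnA yb mul0rn addr0.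
Qed.

(** * Torsion in Khovanov homology *)

Section HomologyElements.
Variables (U V W : zmodType) (f : {additive U -> V}) (g : {additive V -> W}).
Local Open Scope quotient_scope.

Lemma homology_pi0 (z : cycle_group g) :
  (\pi_(homology f g) z == 0) = is_boundary f z.
Proof.
have := @Quotient.idealrBE _ (GRing.ZmodClosed.clone (cycle_group g) (@is_boundary _ _ _ f g)
  _) z 0.
by rewrite subr0 => H; rewrite -(raddf0 \pi_(homology f g)); exact: esym H.
Qed.

Lemma homology_repr (x : homology f g) :
  exists2 z, g z = 0 & forall n, x *+ n = 0 <-> exists u, f u = z *+ n.
Proof.
exists (cycle_val (repr x)); first by apply/eqP; apply: cycle_valP.
move=> n; have -> : x *+ n = \pi_(homology f g) (repr x *+ n) by rewrite raddfMn /= reprK.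
have E : cycle_val (repr x *+ n) = cycle_val (repr x) *+ n by apply: (raddfMn val).
rewrite -E; split=> [/eqP|H]; first by rewrite homology_pi0 => /asboolP.
by apply/eqP; rewrite homology_pi0; apply/asboolP.
Qed.

Lemma homology_trivial : (forall x : homology f g, x = 0) ->
  forall z, g z = 0 -> exists u, f u = z.
Proof.
move=> H z gz; have zc : is_cycle g z by apply/eqP.
have := H (\pi_(homology f g) (CycleGroup zc)) => /eqP.
by rewrite homology_pi0 => /asboolP.
Qed.

End HomologyElements.

(** * The given incidence numbers in terms of integral kernels *)

Section EdgeCoef.
Variables (D : diagram).
Local Notation G := (enhanced_state D).
Implicit Types (s t : state D) (g h : G).

(** The two circles in the existential statements are determined up to order, in which the structure
    constants are symmetric. *)
Lemma edge_coefE s c (P Q : {set {set point D}}) : c \notin s ->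
  (edge_coef s (c |: s) P Q)%:R = local_coef (circles s) (circles (c |: s)) diff_coef P Q.
Proof.
move=> cs; set t := c |: s; rewrite /edge_coef /local_coef -/(old s t) -/(old t s).
case: (P :\: old s t == Q :\: old t s) => //=.
have [C1 [C2 [c12 _ surg]]] := surgery_circles cs; rewrite -/t -/(old s t) -/(old t s) in surg.
move: (old s t) (old t s) surg => o n surg; clear t.
have cI (A : {set {set point D}}) B1 B2 : B1 != B2 ->
    #|A :&: [set B1; B2]| = ((B1 \in A) + (B2 \in A))%N.
  move=> B12; rewrite (cardsD1 B1) (cardsD1 B2) !inE !eqxx [B2 == B1]eq_sym (negPf B12) /=
    !andbT.
  rewrite addnA -[RHS]addn0; congr addn; apply/eqP; rewrite cards_eq0 -subset0.
  by apply/subsetP=> B; rewrite !inE; case: eqP; case: eqP; rewrite //= andbF.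
have cI1 (A : {set {set point D}}) B : #|A :&: [set B]| = (B \in A).
  rewrite (cardsD1 B) !inE eqxx andbT -[RHS]addn0; congr addn; apply/eqP;
    rewrite cards_eq0 -subset0.
  by apply/subsetP=> B'; rewrite !inE; case: eqP; rewrite //= andbF.
have ne21 (A B1 B2 : {set point D}) : B1 != B2 -> ([set B1; B2] == [set A]) = false.
  by move=> B12; apply/eqP=> /(congr1 (fun X : {set {set point D}} => #|X|));
    rewrite cards1 cards2 B12.
case: surg => -[-> ->].
  rewrite cards2 c12 /diff_coef /= cI // cI1; congr (nat_of_bool _)%:R.
  apply/orP/idP => [[]|H].
  - case/existsP=> B1 /existsP[B2 /existsP[B /and4P[B12 /eqP E1 /eqP/set1_inj -> ]]].
    have := cI P _ _ B12; rewrite -E1 cI // => ->.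
    by case: (B1 \in P); case: (B2 \in P); case: (B \in Q).
  - by case/existsP=> B /existsP[B1 /existsP[B2 /and4P[_]]]; rewrite ne21.
  left; apply/existsP; exists C1; apply/existsP; exists C2; apply/existsP; exists (C1 :|: C2).
  rewrite c12 !eqxx /=; move: H.
  by case: (C1 \in P); case: (C2 \in P); case: (_ \in Q).
rewrite cards1 /diff_coef /= cI // cI1; congr (nat_of_bool _)%:R.
apply/orP/idP => [[]|H].
- by case/existsP=> B1 /existsP[B2 /existsP[B /and4P[B12]]]; rewrite eq_sym ne21.
- case/existsP=> B /existsP[B1 /existsP[B2 /and4P[B12 /eqP/set1_inj -> /eqP E1]]].
  have := cI Q _ _ B12; rewrite -E1 cI // => ->.
  by case: (B1 \in Q); case: (B2 \in Q); case: (B \in P).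
right; apply/existsP; exists (C1 :|: C2); apply/existsP; exists C1; apply/existsP; exists C2.
rewrite c12 !eqxx /=; move: H.
by case: (C1 \in Q); case: (C2 \in Q); case: (_ \in P).
Qed.

Lemma incidenceE (R : comNzRingType) g h : incidence R g h = (cube_kernel diff_coef g h)%:~R.
Proof.
rewrite /incidence /cube_kernel /cube_sign mulr_suml rmorph_sum; apply: eq_bigr =>
  c /andP[cs /eqP hE].
rewrite rmorphM rmorph_sign hE -edge_coefE // /=.
by rewrite mulrz_nat.
Qed.

End EdgeCoef.

(** * Bigraded chains inside the total complex *)

Section Chains.
Variables (D : diagram).
Local Notation G := (enhanced_state D).
Local Notation V := {ffun G -> int}.
Local Notation dK := (cube_kernel (D := D) diff_coef).
Local Notation TK := (cube_kernel (D := D) turner_coef).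

Definition of_bideg (i j : int) : pred G := fun g => (i_deg g == i) && (j_deg g == j).

Lemma sum_basis (A : zmodType) i j (F : G -> A) :
  \sum_(b : basis D i j) F (val b) = \sum_(g | of_bideg i j g) F g.
Proof.
rewrite [RHS](reindex_omap val (insub : G -> option (basis D i j))) /=.
  by apply: eq_bigl => b; rewrite valK eqxx andbT; apply: esym (valP b).
by move=> g gij; rewrite insubT.
Qed.

Definition chain_ext i j (z : chain D int i j) : V :=
  [ffun g => (if insub g is Some b then z b else 0) : int].

Definition chain_res (R : comNzRingType) i j (v : V) : chain D R i j := [ffun b =>
  (v (val b))%:~R].

Lemma chain_ext_on i j (z : chain D int i j) : supported (of_bideg i j) (chain_ext z).
Proof. by move=> g gij; rewrite ffunE insubN. Qed.

Lemma chain_extE i j (z : chain D int i j) b : chain_ext z (val b) = z b.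
Proof. by rewrite ffunE valK. Qed.

Lemma chain_extMn i j (z : chain D int i j) n : chain_ext (z *+ n) = chain_ext z *+ n.
Proof.
apply/ffunP=> g; rewrite ffunMnE !ffunE; case: insub => [b|]; first by rewrite ffunMnE.
by rewrite mul0rn.
Qed.

Lemma kernel_op_bideg i j (v : V) h : of_bideg (i + 1) j h ->
  kernel_op dK v h = \sum_(g | of_bideg i j g) v g * dK g h.
Proof.
move=> /andP[/eqP ih /eqP jh]; rewrite ffunE [RHS]big_mkcond; apply: eq_bigr => g _.
case: ifPn => // gij; apply/eqP; rewrite mulf_eq0; apply/orP; right.
apply: contraNT gij => /diff_kernel_deg[]; rewrite ih jh => /addIr-> ->.
by rewrite /of_bideg !eqxx.
Qed.

Lemma diff_chain_res (R : comNzRingType) i i' j (v : V) : i' = i + 1 ->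
  diff i' (chain_res R i j v) = chain_res R i' j (kernel_op dK v).
Proof.
move=> ->; apply/ffunP=> h;
  rewrite [LHS]ffunE [RHS]ffunE (kernel_op_bideg v (valP h)) -(sum_basis i j (fun g : G =>
    (v g * dK g (val h) : int))) rmorph_sum.
by apply: eq_bigr => g _; rewrite ffunE incidenceE rmorphM.
Qed.

Lemma chain_extK i j (z : chain D int i j) : chain_res int i j (chain_ext z) = z.
Proof. by apply/ffunP=> b; rewrite ffunE chain_extE intz. Qed.

Lemma kernel_op_bideg_on i j (v : V) : supported (of_bideg i j) v ->
  supported (of_bideg (i + 1) j) (kernel_op dK v).
Proof.
move=> vij h hN; rewrite ffunE big1 // => g _.
have [gij|gij] := boolP (of_bideg i j g); last by rewrite vij ?mul0r.
suff /eqP -> : dK g h == 0 by rewrite mulr0.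
apply: contraNT hN => /diff_kernel_deg[ih jh]; case/andP: gij => /eqP ig /eqP jg.
by rewrite /of_bideg ih jh ig jg !eqxx.
Qed.

Lemma kernel_op_chain_ext i i' j (z : chain D int i j) : i' = i + 1 ->
  kernel_op dK (chain_ext z) = chain_ext (diff i' z).
Proof.
move=> ->; apply/ffunP=> h; have [hij|hij] := boolP (of_bideg (i + 1) j h); last first.
  by rewrite (kernel_op_bideg_on (chain_ext_on z)) // chain_ext_on.
have E : h = val (Sub h hij : basis D (i + 1) j) by rewrite SubK.
by rewrite E chain_extE -{2}(chain_extK z) diff_chain_res // [RHS]ffunE intz.
Qed.

Lemma F2_lift i j (z : chain D 'F_2 i j) : exists v : V, chain_res 'F_2 i j v = z.
Proof.
exists [ffun g => (if insub g is Some b then (val (z b))%:Z else 0) : int].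
apply/ffunP=> b; rewrite !ffunE valK.
by case: (z b) => [[|[|//]] ?]; apply: val_inj.
Qed.

Lemma F2_eq0 (x : int) : (x%:~R : 'F_2) = 0 <-> exists y, x = y *+ 2.
Proof.
split=> [E|[y ->]]; last by rewrite mulr2n rmorphD /=; case: (y%:~R) => [[|[|//]] ?];
  apply: val_inj.
exists (x %/ 2)%Z; rewrite {1}(divz_eq x 2).
have m2 : ((x %% 2)%Z == 0) || ((x %% 2)%Z == 1) by lia.
case/orP: m2 E => /eqP m2; first by lia.
rewrite (divz_eq x 2) m2 rmorphD rmorphM /= => /eqP.
by rewrite [2%:~R](_ : _ = 0) ?mulr0 ?add0r //; apply: val_inj.
Qed.

Lemma thin_mod2 a : (forall i j, 2 * i - j <> a - 1 -> 2 * i - j <> a + 1 ->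
    forall x : Kh D 'F_2 i j, x = 0) ->
  forall n (c : V), n <> a + 1 - 2 -> n <> a + 1 -> supported (level (@delta_deg D) n) c ->
  (exists w, kernel_op dK c = w *+ 2) -> exists u w, c = kernel_op dK u + w *+ 2.
Proof.
move=> thin n c n1 n2 cn [w dc].
have : forall ij : int * int, exists u : V, forall h, of_bideg ij.1 ij.2 h ->
    exists y, c h - kernel_op dK u h = y *+ 2.
  case=> i j /=; have [ijn|ijn] := eqVneq (2 * i - j) n; last first.
    exists 0 => h /andP[/eqP ih /eqP jh]; exists 0.
    rewrite raddf0 [in X in _ - X]ffunE subr0 mul0rn cn //.
    by rewrite /level /delta_deg ih jh.
  have zc : diff (i + 1) (chain_res 'F_2 i j c) = 0.
    rewrite diff_chain_res // dc; apply/ffunP=> h; rewrite [LHS]ffunE [RHS]ffunE.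
    by apply/F2_eq0; exists (w (val h)); rewrite ffunMnE.
  have [||u uE] := homology_trivial (thin i j _ _) zc; try lia.
  have [v vE] := F2_lift u; exists v => h hij; apply/F2_eq0.
  move: uE; rewrite -vE /= diff_chain_res ?subrK // => /ffunP/(_ (Sub h hij)).
  by rewrite [LHS]ffunE [RHS]ffunE SubK rmorphB /= => ->; rewrite subrr.
move=> /choice[U UP].
(* The differential maps bidegree (i, j) to (i + 1, j), so on (i, j) the primitive chosen for (i +
   1, j) is used. *)
pose u : V := [ffun g => U (i_deg g + 1, j_deg g) g].
have uE h : kernel_op dK u h = kernel_op dK (U (i_deg h, j_deg h)) h.
  rewrite !ffunE; apply: eq_bigr => g _.
  have [->|/diff_kernel_deg[ih jh]] := eqVneq (dK g h) 0; first by rewrite !mulr0.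
  by rewrite ffunE ih jh.
have : forall h, exists y, c h - kernel_op dK u h = y *+ 2.
  by move=> h; rewrite uE; apply: UP; rewrite /of_bideg /= !eqxx.
move=> /choice[y yE]; exists u, [ffun h => y h].
by apply/ffunP=> h; rewrite [RHS]ffunE ffunMnE [X in _ + X *+ _]ffunE -yE addrC subrK.
Qed.

End Chains.

Lemma kernel_op_comp0 (G : finType) (M N : G -> G -> int) :
  (forall v, kernel_op N (kernel_op M v) = 0) -> forall g h, \sum_k M g k * N k h = 0.
Proof.
move=> MN g h; have := kernel_op_comp M N (delta_ffun g) h.
rewrite MN [LHS]ffunE (bigD1 g) //= ffunE eqxx mul1r [X in _ + X]big1 ?addr0 => [<- //|g' g'g].
by rewrite ffunE eq_sym (negPf g'g) mul0r.
Qed.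

Section Torsion.
Variables (D : diagram).
Local Notation G := (enhanced_state D).
Local Notation V := {ffun G -> int}.
Local Notation dK := (cube_kernel (D := D) diff_coef).
Local Notation TK := (cube_kernel (D := D) turner_coef).
Local Notation DK := (cube_kernel (D := D) deformed_coef).

Lemma cube_kernel_deformed g h : DK g h = dK g h + TK g h.
Proof. by rewrite /cube_kernel -mulrDr /local_coef; case: ifP => _; rewrite ?addr0. Qed.

Lemma kernel_op_deformed v : kernel_op DK v = kernel_op dK v + kernel_op TK v.
Proof.
apply/ffunP=> h; rewrite !ffunE -big_split; apply: eq_bigr => g _.
by rewrite cube_kernel_deformed mulrDr.
Qed.

(** The total of the three sums is a coefficient of (d + T)^2. They shift delta by 4, 2 and 0, so
    for given g and h at most one of them can be nonzero. *)
Lemma kernel_squares g h :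
  [/\ \sum_k dK g k * dK k h = 0, \sum_k (dK g k * TK k h + TK g k * dK k h) = 0
    & \sum_k TK g k * TK k h = 0].
Proof.
have E : \sum_k dK g k * dK k h + \sum_k (dK g k * TK k h + TK g k * dK k h) +
    \sum_k TK g k * TK k h = 0.
  transitivity (\sum_k DK g k * DK k h).
    rewrite -!big_split; apply: eq_bigr => k _ /=; rewrite !cube_kernel_deformed.
    move: (dK g k) (dK k h) (TK g k) (TK k h) => a b c d; ring.
  exact: (@kernel_op_comp0 _ DK DK (@deformed_diff_sqr D) g h).
have dd : delta_deg h <> delta_deg g + 4 -> \sum_k dK g k * dK k h = 0.
  move=> H; apply: big1 => k _; apply/eqP; apply: contra_notT H.
  rewrite mulf_eq0 negb_or => /andP[/diff_kernel_delta E1 /diff_kernel_delta ->]; lia.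
have dt : delta_deg h <> delta_deg g + 2 -> \sum_k (dK g k * TK k h + TK g k * dK k h) = 0.
  move=> H; apply: big1 => k _.
  have -> : dK g k * TK k h = 0.
    apply/eqP; apply: contra_notT H.
    rewrite mulf_eq0 negb_or => /andP[/diff_kernel_delta E1 /turner_kernel_delta ->]; lia.
  rewrite add0r; apply/eqP; apply: contra_notT H.
  rewrite mulf_eq0 negb_or => /andP[/turner_kernel_delta E1 /diff_kernel_delta ->]; lia.
have tt : delta_deg h <> delta_deg g -> \sum_k TK g k * TK k h = 0.
  move=> H; apply: big1 => k _; apply/eqP; apply: contra_notT H.
  rewrite mulf_eq0 negb_or => /andP[/turner_kernel_delta E1 /turner_kernel_delta ->]; lia.
have [h4|h4] := eqVneq (delta_deg h) (delta_deg g + 4).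
  by move: E; rewrite dt ?tt ?addr0 => [->||]; try lia.
rewrite dd ?add0r in E *; last exact/eqP.
have [h2|h2] := eqVneq (delta_deg h) (delta_deg g + 2).
  by move: E; rewrite tt ?addr0 => [->|]; try lia.
by rewrite dt ?add0r in E *; last exact/eqP.
Qed.

Lemma diff_sqr v : kernel_op dK (kernel_op dK v) = 0.
Proof.
apply/ffunP=> h; rewrite kernel_op_comp big1 ?ffunE // => g _.
by have [-> _ _] := kernel_squares g h; rewrite mulr0.
Qed.

Lemma turner_sqr v : kernel_op TK (kernel_op TK v) = 0.
Proof.
apply/ffunP=> h; rewrite kernel_op_comp big1 ?ffunE // => g _.
by have [_ _ ->] := kernel_squares g h; rewrite mulr0.
Qed.

Lemma diff_turner v : kernel_op dK (kernel_op TK v) = - kernel_op TK (kernel_op dK v).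
Proof.
apply/eqP; rewrite -addr_eq0; apply/eqP/ffunP=> h;
  rewrite ffunE !kernel_op_comp -big_split ffunE.
apply: big1 => g _ /=; rewrite -mulrDr -big_split /=.
have [_ + _] := kernel_squares g h; under eq_bigr do rewrite addrC.
by move=> ->; rewrite mulr0.
Qed.

Lemma diff_nu v : kernel_op dK (kernel_op (@nu_kernel D) v) =
  kernel_op (@nu_kernel D) (kernel_op dK v) + kernel_op TK v *+ 2.
Proof.
apply/ffunP=> h; rewrite [RHS]ffunE ffunMnE !kernel_op_comp [X in _ + X *+ _]ffunE -sumrMnl
  -big_split.
apply: eq_bigr => g _ /=; rewrite -mulrnAr -mulrDr -cube_kernel_derivation addrC subrK //.
Qed.

Lemma chain_torsion k i j (z : chain D int i j) (u : chain D int (i - 1) j) :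
  H_thin 'F_2 D -> diff (i + 1) z = 0 -> z *+ 2 ^ k.+1 = diff i u ->
  exists m (u' : chain D int (i - 1) j), odd m /\ z *+ (2 * m) = diff i u'.
Proof.
case=> a thin dz zu.
have E1 : i = i - 1 + 1 by rewrite subrK.
(* A diagram without points has no base point, but it has no crossings either, so its differential
   vanishes. *)
have [p0 _|nop] := pickP (fun _ : point D => true); last first.
  exists 1%N, 0; split=> //; rewrite raddf0.
  have du : diff i u = 0.
    apply/ffunP=> h; rewrite !ffunE big1 // => g _.
    rewrite /incidence big_pred0 ?mulr0 // => c.
    by have := nop (crossing_end c 0).
  have -> : z = 0; last by rewrite mul0rn.
  apply/ffunP=> b; have := congr1 (fun f : chain D int i j => f b) zu.
  rewrite /= du ffunMnE !ffunE => /eqP; rewrite mulrn_eq0 expn_eq0 /= => /eqP //.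
have zn : supported (level (@delta_deg D) (2 * i - j)) (chain_ext z).
  apply: supportedW (chain_ext_on z) => g /andP[/eqP ig /eqP jg].
  by rewrite /level /delta_deg ig jg.
have dz' : kernel_op dK (chain_ext z) = 0.
  rewrite (kernel_op_chain_ext (i' := i + 1)) // dz; apply/ffunP=> g; rewrite !ffunE.
  by case: insub => // b; rewrite ffunE.
have zu' : chain_ext z *+ 2 ^ k.+1 = kernel_op dK (chain_ext u).
  by rewrite (kernel_op_chain_ext _ E1) -zu chain_extMn.
have [m [v [mo E]]] : exists m (u' : V), odd m /\ chain_ext z *+ (2 * m) = kernel_op dK u'.
  (* K takes the upper of the diagonals a - 1 and a + 1, hence b = a + 1. *)
  apply: (@cone_torsion _ (@delta_deg D) (based p0) (kernel_op dK) (kernel_op TK) (kernel_op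
    (@nu_kernel D)) (a + 1)
           _ _ _ _ _ _ _ _ _ _ _ _ _ k _ _ _ zn dz' zu').
  - by move=> n v; apply/kernel_op_lev/diff_kernel_delta.
  - by move=> n v; rewrite -[in RHS](addr0 n); apply/kernel_op_lev/turner_kernel_delta.
  - by move=> n v; apply/kernel_op_lev/nu_kernel_delta.
  - by move=> v; apply: kernel_op_on => g h gh gK; apply: (cube_kernel_based _ gK).1.
  - by move=> v; apply: kernel_op_on => g h gh gK; apply: (cube_kernel_based _ gK).2.
  - exact: diff_sqr.
  - exact: diff_turner.
  - exact: turner_sqr.
  - move=> y w _ wK; rewrite -kernel_op_deformed => /(deformed_torsion_free wK)[p pK ->].
    by exists p; rewrite // kernel_op_deformed.
  - exact: diff_nu.
  - exact: based_decomposition.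
  - exact: based_decomposition_uniq.
  - exact: thin_mod2.
exists m, (chain_res int (i - 1) j v); split=> //.
rewrite diff_chain_res // -E -chain_extMn; exact/esym/chain_extK.
Qed.

End Torsion.

Theorem mainTheorem1 (D : diagram) (k : nat) :
  H_thin 'F_2 D -> (1 < k)%N ->
  ~ exists x : direct_sum (Kh D int), has_order x (2 ^ k).
Proof.
move=> thin k1 [x [_ x0 xmin]]; case: k k1 x0 xmin => [|[|k]] // _ x0 xmin.
apply: (xmin (2 ^ k.+1)%N); first by rewrite expn_gt0 ltn_exp2l /=.
move=> i j; have [z gz xz] := homology_repr (x i j).
have [u zu] := (xz _).1 (x0 i j).
have [m [u' [mo E]]] := chain_torsion thin gz (esym zu).
have xm : x i j *+ (2 * m) = 0 by apply/xz; exists u'.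
rewrite expnS mulrnA.
(* The odd [m] depends on the bidegree; being coprime to the order it drops out, which leaves the
   factor 2 uniformly in all bidegrees. *)
have -> : x i j *+ 2 = 0; last by rewrite mul0rn.
apply: (@mulrn_coprime _ _ m (2 ^ k.+1)).
- by rewrite coprime_sym coprimeXl // coprime2n.
- by rewrite -mulrnA.
- by rewrite -mulrnA -expnS.
Qed.
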